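(* There exists an absolute constant $c>0$ and an algorithm such that, for all integers $m,n\ge 2$ and every sortable $m\times n$ instance $A$ of the Torus Puzzle, the algorithm outputs a sequence of at most $c\cdot mn\log\max\{m,n\}$ rotations, each of which is either a unit downward rotation of a column or a unit rightward rotation of a row, whose application to $A$ yields the sorted configuration.
   Context: An $m\times n$ instance of the Torus Puzzle is an $m\times n$ matrix $A$ whose entries are the integers $1,2,\dots,mn$, each appearing exactly once. Rows and columns are numbered from $1$. The sorted configuration is the matrix whose entry in row $i$, column $j$ is $(i-1)n+j$. A unit rightward rotation of row $i$ moves the element in column $j$ of row $i$ to column $j+1$ for $j<n$, and the element in column $n$ to column $1$ (all other entries unchanged). A unit downward rotation of column $j$ moves the element in row $i$ of column $j$ to row $i+1$ for $i<m$, and the element in row $m$ to row $1$. Unit leftward/upward rotations are the inverse operations. An instance is sortable if some finite sequence of unit row and column rotations (in any directions) transforms it into the sorted configuration. Rotations in a sequence are applied from left to right. *)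

(* Defs.v *)
From Stdlib Require Import Reals.
From mathcomp Require Import all_boot all_order all_algebra.

Set Implicit Arguments.
Unset Strict Implicit.
Unset Printing Implicit Defensive.

(* MathComp rebinds the delimiter %R to ring_scope; the real numbers below are
   Stdlib's R, whose scope gets the delimiter %Re. *)
Delimit Scope R_scope with Re.

(* Rows and columns are indexed from 0 by 'I_m and 'I_n. *)

Definition torus_instance m n (A : 'M[nat]_(m, n)) : Prop :=
  perm_eq [seq A ij.1 ij.2 | ij : 'I_m * 'I_n] (iota 1 (m * n)).

(* With 1-based indices i+1 and j+1 this is ((i+1)-1)n + (j+1). *)
Definition sorted_mx m n : 'M[nat]_(m, n) := \matrix_(i, j) (i * n + j + 1)%N.

Inductive rotation (m n : nat) : Type :=
| RowRight of 'I_m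
| RowLeft of 'I_m
| ColDown of 'I_n
| ColUp of 'I_n.

Arguments RowRight {m n} _.
Arguments RowLeft {m n} _.
Arguments ColDown {m n} _.
Arguments ColUp {m n} _.

(* [ordS] and [ord_pred] are the cyclic successor and predecessor.  The entry
   found at column j after a rightward rotation comes from column j - 1; and
   similarly in the other directions. *)
Definition rotate m n (A : 'M[nat]_(m, n)) (r : rotation m n) : 'M[nat]_(m, n) :=
  match r with
  | RowRight i0 => \matrix_(i, j) if i == i0 then A i (ord_pred j) else A i j
  | RowLeft i0 => \matrix_(i, j) if i == i0 then A i (ordS j) else A i j
  | ColDown j0 => \matrix_(i, j) if j == j0 then A (ord_pred i) j else A i j
  | ColUp j0 => \matrix_(i, j) if j == j0 then A (ordS i) j else A i j
  end.

Definition rotate_seq m n (A : 'M[nat]_(m, n)) (s : seq (rotation m n)) :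
  'M[nat]_(m, n) := foldl (@rotate m n) A s.

Definition sortable m n (A : 'M[nat]_(m, n)) : Prop :=
  exists s : seq (rotation m n), rotate_seq A s = sorted_mx m n.

Definition right_or_down m n (r : rotation m n) : bool :=
  match r with
  | RowRight _ | ColDown _ => true
  | RowLeft _ | ColUp _ => false
  end.

(* Algorithms are programs for Kleene's partial recursive functions.
   [eval p xs y] means that p halts on the arguments xs with value y; in
   [PrimRec f g] the first argument is the recursion variable, and [Mu f] searches
   for the least first argument at which f vanishes. *)
Inductive program : Type :=
| ZeroFun
| SuccFun
| Proj of nat
| CompFun of program & seq program
| PrimRec of program & program
| Mu of program.

Inductive eval : program -> seq nat -> nat -> Prop :=
| eval_ZeroFun xs : eval ZeroFun xs 0
| eval_SuccFun x : eval SuccFun [:: x] x.+1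
| eval_Proj i xs : i < size xs -> eval (Proj i) xs (nth 0 xs i)
| eval_CompFun f gs xs ys z :
    evals gs xs ys -> eval f ys z -> eval (CompFun f gs) xs z
| eval_PrimRec0 f g xs y : eval f xs y -> eval (PrimRec f g) (0 :: xs) y
| eval_PrimRecS f g k xs y z :
    eval (PrimRec f g) (k :: xs) y -> eval g [:: k, y & xs] z ->
    eval (PrimRec f g) (k.+1 :: xs) z
| eval_Mu f xs k (v : nat -> nat) :
    (forall j, j < k -> eval f (j :: xs) (v j).+1) ->
    eval f (k :: xs) 0 -> eval (Mu f) xs k
with evals : seq program -> seq nat -> seq nat -> Prop :=
| evals_nil xs : evals [::] xs [::]
| evals_cons g gs xs y ys :
    eval g xs y -> evals gs xs ys -> evals (g :: gs) xs (y :: ys).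

Scheme eval_mut := Induction for eval Sort Prop
with evals_mut := Induction for evals Sort Prop.

Lemma eval_fun p xs y z : eval p xs y -> eval p xs z -> y = z.
Proof.
move=> e; move: z; move: p xs y e.
apply: (@eval_mut (fun p xs y _ => forall z, eval p xs z -> y = z)
  (fun gs xs ys _ => forall zs, evals gs xs zs -> ys = zs)).
- by move=> xs z e; inversion e.
- by move=> x z e; inversion e.
- by move=> i xs lt_i z e; inversion e.
- move=> f gs xs ys z _ IHg _ IHf z' e.
  inversion e as [| | |? ? ? zs ? eg ef| | |]; subst.
  by apply: IHf; rewrite (IHg _ eg).
- move=> f g xs y _ IH z e.
  by inversion e as [| | | |? ? ? ? ef| |]; subst; apply: IH.
- move=> f g k xs y z _ IH1 _ IH2 z' e.
  inversion e as [| | | | |? ? ? ? u ? e1 e2|]; subst.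
  by apply: IH2; rewrite (IH1 _ e1).
- move=> f xs k v _ IHv _ IH0 z e.
  inversion e as [| | | | | |? ? ? w ew e0]; subst.
  case: (ltngtP k z) => // [lt_kz | lt_zk].
  + by have := IH0 _ (ew _ lt_kz).
  + by have := IHv _ lt_zk _ e0.
- by move=> xs zs e; inversion e.
- move=> g gs xs y ys _ IH1 _ IH2 zs e.
  inversion e as [|? ? ? u us e1 e2]; subst.
  by rewrite (IH1 _ e1) (IH2 _ e2).
Qed.

Definition rotation_code m n (r : rotation m n) : nat :=
  match r with
  | RowRight i => 4 * i
  | ColDown j => 4 * j + 1
  | RowLeft i => 4 * i + 2
  | ColUp j => 4 * j + 3
  end.

(* [CodeSeq.code] is a bijection between finite sequences of naturals and
   naturals; the entries of A are listed in row-major order. *)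
Definition program_input m n (A : 'M[nat]_(m, n)) : seq nat :=
  [:: m; n; CodeSeq.code [seq A i j | i <- enum 'I_m, j <- enum 'I_n]].

Definition outputs (p : program) m n (A : 'M[nat]_(m, n))
    (s : seq (rotation m n)) : Prop :=
  eval p (program_input A) (CodeSeq.code (map (@rotation_code m n) s)).

(* Main.v *)
Require Import Defs.
From Stdlib Require Import Reals Lra Psatz.
From mathcomp Require Import all_boot all_order all_algebra all_fingroup.
From mathcomp Require Import zify.

(* Rotations are permutations of the m * n cells.  While one row makes a full
   turn, each column can be moved down once, at the moment when a prescribed
   cell of that row faces it; so the simultaneous downward shift of all
   columns, conjugated by an arbitrary permutation f of one row, costs only 2n
   rotations.  A product of m such conjugates permutes all rows but one
   arbitrarily and in parallel, and products of their powers give f^-1 on one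
   row together with f on another, hence any commutator on a single row, all at
   cost O(mn).  A permutation is a product of two involutions, from which an even
   one is a product of three commutators; so any even permutation of a single
   line costs O(mn).  By Hall's theorem every permutation of the cells is a
   product of a row, a column and a row permutation, and the leftover
   transpositions are traded for one another by products of two transpositions,
   again at cost O(mn).  Thus 700 mn rotations suffice.
   The program enumerates the words in rightward and downward rotations by
   increasing length and returns the first one that sorts the instance. *)

Set Implicit Arguments.
Unset Strict Implicit.
Unset Printing Implicit Defensive.

(** * Programs *)

(** The arity is fixed and only lists of that length matter, so a function may read its arguments by
    [nth 0]. *)
Definition computable n (f : seq nat -> nat) :=
  exists p, forall xs, size xs = n -> eval p xs (f xs).

Lemma computable_ext n f g :
  (forall xs, size xs = n -> f xs = g xs) -> computable n f -> computable n g.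
Proof. by move=> fg [p pP]; exists p => xs sz; rewrite -fg //; exact: pP. Qed.

Lemma computable_var n i : i < n -> computable n (nth 0 ^~ i).
Proof. by move=> lt_i; exists (Proj i) => xs sz; apply: eval_Proj; rewrite sz. Qed.

Lemma computable_compS n h (g : seq nat -> nat) :
  computable 1 h -> computable n g -> computable n (fun xs => h [:: g xs]).
Proof.
move=> [p pP] [q qP]; exists (CompFun p [:: q]) => xs sz.
apply: (eval_CompFun (ys := [:: g xs])); last exact: pP.
by apply: evals_cons (evals_nil _); exact: qP.
Qed.

Lemma computable_comp n k h (gs : seq (seq nat -> nat)) :
  computable k h -> size gs = k -> (forall i, i < k -> computable n (nth (fun=> 0) gs i)) ->
  computable n (fun xs => h [seq g xs | g : seq nat -> nat <- gs]).
Proof.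
move=> [p pP] sz cgs.
have [qs qsP] : exists qs, forall xs, size xs = n -> evals qs xs [seq g xs | g : seq nat -> nat <- gs].
  elim: gs k sz cgs {pP} => [|g gs IH] [|k] //=.
    by move=> _ _; exists [::] => xs _; exact: evals_nil.
  move=> [sz] cgs; have [qs qsP] := IH k sz (fun i => cgs i.+1).
  have [q qP] := cgs 0 isT; exists (q :: qs) => xs xsn.
  by apply: evals_cons; [exact: qP | exact: qsP].
exists (CompFun p qs) => xs xsn; apply: eval_CompFun (qsP _ xsn) _.
by apply: pP; rewrite size_map.
Qed.

Lemma computable_succ n f : computable n f -> computable n (fun xs => (f xs).+1).
Proof.
move=> cf; apply: (computable_compS (h := fun xs => (nth 0 xs 0).+1)) cf.
by exists SuccFun => -[|x [|]] //= _; exact: eval_SuccFun.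
Qed.

Lemma computable_const n c : computable n (fun=> c).
Proof.
elim: c => [|c]; last exact: computable_succ.
by exists ZeroFun => xs _; exact: eval_ZeroFun.
Qed.

(** A composition hands its outer program only the values of the inner ones; these projections pass
    the original arguments on to a recursion. *)
Lemma evals_projs xs i k : i + k = size xs ->
  evals [seq Proj j | j <- iota i k] xs (drop i xs).
Proof.
elim: k i => [|k IH] i e.
  by rewrite drop_oversize -?e ?addn0 //; exact: evals_nil.
have lt_i : i < size xs by lia.
rewrite (drop_nth 0 lt_i) /=; apply: evals_cons; first exact: eval_Proj.
by apply: IH; rewrite addSnnS.
Qed.

(* The body of the recursion sees the counter, the accumulator and the
   arguments as one argument list, in the order of [PrimRec]. *)
Lemma computable_iteri n c b (body : nat -> nat -> seq nat -> nat) :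
  computable n c -> computable n b ->
  computable n.+2 (fun ys => body (nth 0 ys 0) (nth 0 ys 1) (behead (behead ys))) ->
  computable n (fun xs => iteri (c xs) (fun k y => body k y xs) (b xs)).
Proof.
move=> [pc pcP] [pb pbP] [ph phP].
exists (CompFun (PrimRec pb ph) (pc :: [seq Proj i | i <- iota 0 n])) => xs sz.
apply: (eval_CompFun (ys := c xs :: xs)).
  apply: evals_cons; first exact: pcP.
  by rewrite -[X in evals _ _ X]drop0; apply: evals_projs.
elim: (c xs) => [|k IH]; first by apply: eval_PrimRec0; exact: pbP.
by apply: eval_PrimRecS IH _; apply: (phP [:: _, _ & xs]); rewrite /= sz.
Qed.

Lemma computable_outer_var n i : i < n -> computable n.+2 (fun ys => nth 0 (behead (behead ys)) i).
Proof.
move=> lt_i; apply: computable_ext (computable_var (i := i.+2) _) => // xs _.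
by rewrite !nth_behead.
Qed.

Definition computable2 (h : nat -> nat -> nat) :=
  computable 2 (fun xs => h (nth 0 xs 0) (nth 0 xs 1)).
Definition computable3 (h : nat -> nat -> nat -> nat) :=
  computable 3 (fun xs => h (nth 0 xs 0) (nth 0 xs 1) (nth 0 xs 2)).
Definition computable4 (h : nat -> nat -> nat -> nat -> nat) :=
  computable 4 (fun xs => h (nth 0 xs 0) (nth 0 xs 1) (nth 0 xs 2) (nth 0 xs 3)).

Section Application.

Variables (n : nat) (f g f' g' : seq nat -> nat).
Hypotheses (cf : computable n f) (cg : computable n g).

Lemma computable_app2 h : computable2 h -> computable n (fun xs => h (f xs) (g xs)).
Proof.
by move=> ch; apply: (computable_comp (gs := [:: f; g]) ch) => // -[|[|]].
Qed.

Hypothesis cf' : computable n f'.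

Lemma computable_app3 h :
  computable3 h -> computable n (fun xs => h (f xs) (g xs) (f' xs)).
Proof.
by move=> ch; apply: (computable_comp (gs := [:: f; g; f']) ch) => // -[|[|[|]]].
Qed.

Hypothesis cg' : computable n g'.

Lemma computable_app4 h :
  computable4 h -> computable n (fun xs => h (f xs) (g xs) (f' xs) (g' xs)).
Proof.
by move=> ch; apply: (computable_comp (gs := [:: f; g; f'; g']) ch) => // -[|[|[|[|]]]].
Qed.

End Application.

Ltac computable_vars := try (exact: computable_outer_var || exact: computable_var || exact: computable_const).

Lemma computable2_add : computable2 addn.
Proof.
apply: (@computable_ext _ (fun xs => iteri (nth 0 xs 1) (fun _ y => y.+1) (nth 0 xs 0))).
  by move=> xs _; elim: (nth 0 xs 1) => [|k IH] /=; rewrite ?addn0 // addnS IH.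
by apply: (computable_iteri (body := fun _ y _ => y.+1)); computable_vars; apply: computable_succ; computable_vars.
Qed.

Lemma computable_add n f g :
  computable n f -> computable n g -> computable n (fun xs => f xs + g xs).
Proof. by move=> cf cg; apply: computable_app2 computable2_add. Qed.

Lemma computable_pred n f : computable n f -> computable n (fun xs => (f xs).-1).
Proof.
move=> cf; apply: (computable_compS (h := fun xs => (nth 0 xs 0).-1)) cf.
(* The last value of the counter is the predecessor. *)
apply: (@computable_ext _ (fun xs => iteri (nth 0 xs 0) (fun k _ => k) 0)).
  by move=> xs _; case: (nth 0 xs 0).
by apply: (computable_iteri (body := fun k _ _ => k)); computable_vars.
Qed.

Lemma computable2_sub : computable2 subn.
Proof.
apply: (@computable_ext _ (fun xs => iteri (nth 0 xs 1) (fun _ y => y.-1) (nth 0 xs 0))).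
  by move=> xs _; elim: (nth 0 xs 1) => [|k IH] /=; rewrite ?subn0 // subnS IH.
by apply: (computable_iteri (body := fun _ y _ => y.-1)); computable_vars; apply: computable_pred; computable_vars.
Qed.

Lemma computable_sub n f g :
  computable n f -> computable n g -> computable n (fun xs => f xs - g xs).
Proof. by move=> cf cg; apply: computable_app2 computable2_sub. Qed.

Lemma computable2_mul : computable2 muln.
Proof.
apply: (@computable_ext _ (fun xs => iteri (nth 0 xs 1) (fun _ y => y + nth 0 xs 0) 0)).
  by move=> xs _; elim: (nth 0 xs 1) => [|k IH] /=; rewrite ?muln0 // mulnSr IH.
apply: (computable_iteri (body := fun _ y xs => y + nth 0 xs 0)); computable_vars.
by apply: computable_add; computable_vars.
Qed.

Lemma computable_mul n f g :
  computable n f -> computable n g -> computable n (fun xs => f xs * g xs).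
Proof. by move=> cf cg; apply: computable_app2 computable2_mul. Qed.

Lemma computable_exp2 n f : computable n f -> computable n (fun xs => 2 ^ f xs).
Proof.
move=> cf; apply: (computable_compS (h := fun xs => 2 ^ nth 0 xs 0)) cf.
apply: (@computable_ext _ (fun xs => iteri (nth 0 xs 0) (fun _ y => y + y) 1)).
  by move=> xs _; elim: (nth 0 xs 0) => [|k IH] //=; rewrite IH addnn -mul2n expnS.
apply: (computable_iteri (body := fun _ y _ => y + y)); computable_vars.
by apply: computable_add; computable_vars.
Qed.

Lemma computable_leq n f g :
  computable n f -> computable n g -> computable n (fun xs => f xs <= g xs).
Proof.
move=> cf cg; apply: (@computable_ext _ (fun xs => 1 - (f xs - g xs))).
  by move=> xs _; rewrite /leq; case: (f xs - g xs).
by apply: computable_sub; [exact: computable_const | exact: computable_sub].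
Qed.

Lemma computable_eq n f g :
  computable n f -> computable n g -> computable n (fun xs => f xs == g xs).
Proof.
move=> cf cg; apply: (@computable_ext _ (fun xs => (f xs <= g xs) * (g xs <= f xs))).
  by move=> xs _; rewrite mulnb -eqn_leq.
by apply: computable_mul; exact: computable_leq.
Qed.

Lemma computable_if n (c : seq nat -> bool) f g :
  computable n c -> computable n f -> computable n g ->
  computable n (fun xs => if c xs then f xs else g xs).
Proof.
move=> cc cf cg; apply: (@computable_ext _ (fun xs => c xs * f xs + (1 - c xs) * g xs)).
  by move=> xs _; case: (c xs); rewrite mul1n // addn0.
apply: computable_add; apply: computable_mul => //.
by apply: computable_sub; first exact: computable_const.
Qed.

Lemma computable2_div : computable2 divn.
Proof.
(* The quotient grows at counter [k] exactly when [q.+1] copies of the divisor fit into [k.+1]; the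
   factor [0 < nth 0 xs 1] keeps it at 0 for divisor 0, the convention of [%/]. *)
apply: (@computable_ext _ (fun xs => iteri (nth 0 xs 0)
  (fun k q => if (0 < nth 0 xs 1) * (q.+1 * nth 0 xs 1 <= k.+1) == 1 then q.+1 else q) 0)).
  move=> xs _; move: (nth 0 xs 0) (nth 0 xs 1) => x d.
  have [->|d0] := posnP d.
    by rewrite divn0; elim: x => // x IH /=.
  elim: x => [|x IH] /=; first by rewrite div0n.
  rewrite IH mul1n eqb1; have lt_x := ltn_ceil x d0; apply/esym/eqP.
  case: leqP => le_x; rewrite eqn_leq -[X in X && _]ltnS ltn_divLR // leq_divRL //.
    by rewrite le_x andbT mulSn; lia.
  by rewrite le_x (leq_trans (leq_trunc_div x d)).
apply: (computable_iteri (body := fun k q xs =>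
  if (0 < nth 0 xs 1) * (q.+1 * nth 0 xs 1 <= k.+1) == 1 then q.+1 else q)); computable_vars.
apply: computable_if; computable_vars; last by apply: computable_succ; computable_vars.
apply: computable_eq; computable_vars; apply: computable_mul; apply: computable_leq; computable_vars.
  by apply: computable_mul; computable_vars; apply: computable_succ; computable_vars.
by apply: computable_succ; computable_vars.
Qed.

Lemma computable_div n f g :
  computable n f -> computable n g -> computable n (fun xs => f xs %/ g xs).
Proof. by move=> cf cg; apply: computable_app2 computable2_div. Qed.

Lemma computable_mod n f g :
  computable n f -> computable n g -> computable n (fun xs => f xs %% g xs).
Proof.
move=> cf cg; apply: (@computable_ext _ (fun xs => f xs - f xs %/ g xs * g xs)).
  by move=> xs _; rewrite {1}(divn_eq (f xs) (g xs)) addKn.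
apply: computable_sub => //; apply: computable_mul => //; exact: computable_div.
Qed.

Ltac computable := repeat lazymatch goal with
  | |- computable _ (fun xs => nat_of_bool (@?f xs == @?g xs)) => apply: (@computable_eq _ f g)
  | |- computable _ (fun xs => nat_of_bool (@?f xs <= @?g xs)) => apply: (@computable_leq _ f g)
  | |- computable _ (fun xs => @?f xs + @?g xs) => apply: (@computable_add _ f g)
  | |- computable _ (fun xs => @?f xs - @?g xs) => apply: (@computable_sub _ f g)
  | |- computable _ (fun xs => @?f xs * @?g xs) => apply: (@computable_mul _ f g)
  | |- computable _ (fun xs => @?f xs %/ @?g xs) => apply: (@computable_div _ f g)
  | |- computable _ (fun xs => @?f xs %% @?g xs) => apply: (@computable_mod _ f g)
  | |- computable _ (fun xs => 2 ^ @?f xs) => apply: (@computable_exp2 _ f)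
  | |- computable _ (fun xs => (@?f xs).-1) => apply: (@computable_pred _ f)
  | |- computable _ (fun xs => (@?f xs).+1) => apply: (@computable_succ _ f)
  | |- _ => first [ assumption | exact: computable_const | exact: computable_var
                  | exact: computable_outer_var ]
  end.

(* Bijective base-B numeration, least significant digit first: every word in the
   digits 0, ..., B - 1 has exactly one code, and longer words have larger codes,
   so that minimization over the codes finds a shortest word.  [digits_rest B t k]
   is the code left after t digits; 0 is the code of the empty word. *)
Definition digits_rest B t k := iter t (fun r => r.-1 %/ B) k.
Definition digit B t k := (digits_rest B t k).-1 %% B.
Definition digits_upto B f k := [seq digit B t k | t <- iota 0 f & 0 < digits_rest B t k].
Definition digits B k := digits_upto B k k.

Lemma leq_digits_rest B t k k' : k <= k' -> digits_rest B t k <= digits_rest B t k'.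
Proof. by move=> kk; elim: t => //= t IH; apply: leq_div2r; lia. Qed.

Lemma digits_rest_sub B t k : digits_rest B t k <= k - t.
Proof.
elim: t => [|t IH] /=; first by rewrite subn0.
by apply: leq_trans (leq_div _ _) _; lia.
Qed.

(** Every step lowers a positive rest, so after [k] steps the rest is 0 and further fuel adds no
    digit. *)
Lemma digits_uptoE B f k : k <= f -> digits_upto B f k = digits B k.
Proof.
move=> kf; rewrite /digits /digits_upto -(subnKC kf) iotaD filter_cat.
rewrite [X in _ ++ X](_ : _ = [::]) ?cats0 //; apply/eqP; rewrite -size_eq0 size_filter -leqn0 leqNgt -has_count.
apply/hasPn => t; rewrite mem_iota add0n => /andP[kt _].
by have := digits_rest_sub B t k; lia.
Qed.

(** The recursion used in proofs; the definition with fuel and a filter is the form that a bounded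
    iteration can compute. *)
Lemma digitsS B k : digits B k.+1 = k %% B :: digits B (k %/ B).
Proof.
rewrite -(digits_uptoE B (leq_div k B)) /digits /digits_upto /= -[1]addn0 iotaDl.
rewrite filter_map -map_comp; congr (_ :: _).
have e t : digits_rest B (1 + t) k.+1 = digits_rest B t (k %/ B).
  by rewrite /digits_rest add1n iterSr.
rewrite (eq_filter (a2 := fun t => 0 < digits_rest B t (k %/ B))) => [|t]; last exact: (congr1 (leq 1) (e t)).
by apply: eq_map => t; exact: (congr1 (fun r => r.-1 %% B) (e t)).
Qed.

Lemma size_digits_leq B k k' : k <= k' -> size (digits B k) <= size (digits B k').
Proof.
move=> kk; rewrite -(digits_uptoE B kk) !size_map !size_filter.
by apply: sub_count => t lt; apply: leq_trans lt (leq_digits_rest _ _ kk).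
Qed.

Lemma digits_onto B s : all (fun d => d < B) s -> exists k, digits B k = s.
Proof.
elim: s => [|d s IH] /=; first by exists 0.
(* The successor keeps 0 free for the empty word. *)
case/andP => dB /IH[k <-]; exists (k * B + d).+1.
rewrite digitsS modnMDl modn_small // divnMDl ?divn_small ?addn0 //.
exact: leq_ltn_trans dB.
Qed.

Lemma all_digits B k : 0 < B -> all (fun d => d < B) (digits B k).
Proof. by move=> B0; apply/allP => _ /mapP[t _ ->]; rewrite ltn_mod. Qed.

Lemma iteri_foldl T k (h : nat -> T -> T) x :
  iteri k h x = foldl (fun y t => h t y) x (iota 0 k).
Proof. by elim: k => // k IH; rewrite iteriS IH -[in RHS]addn1 iotaD foldl_cat. Qed.

(** A right fold starts from the last element while the counter of [iteri] goes up, hence the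
    reversed index. *)
Lemma iteri_foldr T c k (h : nat -> T -> T) x :
  iteri k (fun t => h (c + k - t.+1)) x = foldr h x (iota c k).
Proof.
elim: k c => // k IH c; rewrite iteriS addnK /= -IH.
by congr (h c _); apply: eq_iteri => t y; rewrite addSnnS.
Qed.

(** Testing the rest inside the loop replaces the filter, so that a fold over the digits becomes an
    iteration of exactly [k] steps. *)
Lemma foldl_digits T B (h : T -> nat -> T) k x :
  foldl (fun y t => if 0 < digits_rest B t k then h y (digit B t k) else y) x (iota 0 k) =
  foldl h x (digits B k).
Proof.
rewrite /digits /digits_upto; elim: (iota 0 k) x => //= t s IH x.
by rewrite IH; case: ifP.
Qed.

Lemma foldr_digits T B (h : nat -> T -> T) k x :
  foldr (fun t y => if 0 < digits_rest B t k then h (digit B t k) y else y) x (iota 0 k) =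
  foldr h x (digits B k).
Proof.
rewrite /digits /digits_upto; elim: (iota 0 k) => //= t s IH.
by rewrite IH; case: ifP.
Qed.

(* The cell (i, j) has number i * n + j; a digit d < m rotates row d rightward,
   and the digit m + j rotates column j downward. *)
Definition move_cell m n d p :=
  if d < m then
    if p %/ n == d then p %/ n * n + (p %% n).+1 %% n else p
  else if p %% n == d - m then (p %/ n).+1 %% m * n + p %% n else p.

Definition digit_code m d := if d < m then 4 * d else 4 * (d - m) + 1.

Definition track m n k p := foldl (fun q d => move_cell m n d q) p (digits (m + n) k).
Definition output_code m n k := CodeSeq.code (map (digit_code m) (digits (m + n) k)).
(* The code of the only instance that the word k sorts. *)
Definition matrix_code m n k :=
  CodeSeq.code [seq (track m n k p).+1 | p <- iota 0 (m * n)].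

Lemma computable3_rest : computable3 digits_rest.
Proof.
apply: (@computable_ext _ (fun xs => iteri (nth 0 xs 1)
  (fun _ r => r.-1 %/ nth 0 xs 0) (nth 0 xs 2))).
  by move=> xs _; rewrite /digits_rest; elim: (nth 0 xs 1) => //= t ->.
by apply: (computable_iteri (body := fun _ r xs => r.-1 %/ nth 0 xs 0)); computable.
Qed.

Lemma computable4_move_cell : computable4 move_cell.
Proof. by apply: computable_if; [|apply: computable_if|apply: computable_if]; computable. Qed.

Lemma computable4_track : computable4 track.
Proof.
pose body t q xs :=
  let m := nth 0 xs 0 in let n := nth 0 xs 1 in let k := nth 0 xs 2 in
  if 0 < digits_rest (m + n) t k then move_cell m n (digit (m + n) t k) q else q.
apply: (@computable_ext _ (fun xs => iteri (nth 0 xs 2) (fun t q => body t q xs) (nth 0 xs 3))).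
  by move=> xs _; rewrite iteri_foldl (foldl_digits _ (fun q d => move_cell _ _ d q)).
have crest : computable 6 (fun ys => digits_rest (nth 0 (behead (behead ys)) 0 + nth 0 (behead (behead ys)) 1)
    (nth 0 ys 0) (nth 0 (behead (behead ys)) 2)).
  by apply: computable_app3 computable3_rest; computable.
apply: (computable_iteri (body := body)); computable.
apply: computable_if; computable.
by apply: computable_app4 computable4_move_cell; rewrite /digit; computable.
Qed.

Lemma computable3_output_code : computable3 output_code.
Proof.
(* [CodeSeq.code] is the right fold of [2 ^ d * y.*2.+1] from 0, so the digits are read from the
   last to the first. *)
pose body t y xs :=
  let m := nth 0 xs 0 in let n := nth 0 xs 1 in let k := nth 0 xs 2 in
  if 0 < digits_rest (m + n) (0 + k - t.+1) k
  then 2 ^ digit_code m (digit (m + n) (0 + k - t.+1) k) * (y + y).+1 else y.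
apply: (@computable_ext _ (fun xs => iteri (nth 0 xs 2) (fun t y => body t y xs) 0)).
  move=> xs _; set m := nth 0 xs 0; set n := nth 0 xs 1; set k := nth 0 xs 2.
  rewrite /output_code /CodeSeq.code foldr_map -(foldr_digits _ (fun d y => 2 ^ digit_code m d * y.*2.+1)).
  rewrite -(iteri_foldr 0); apply: eq_iteri => t y; rewrite /body -/m -/n -/k.
  by rewrite addnn.
have crest : computable 5 (fun ys => digits_rest (nth 0 (behead (behead ys)) 0 + nth 0 (behead (behead ys)) 1)
    (0 + nth 0 (behead (behead ys)) 2 - (nth 0 ys 0).+1) (nth 0 (behead (behead ys)) 2)).
  by apply: computable_app3 computable3_rest; computable.
apply: (computable_iteri (body := body)); computable.
apply: computable_if; computable.
by apply: computable_if; rewrite /digit; computable.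
Qed.

Lemma computable3_matrix_code : computable3 matrix_code.
Proof.
pose body t y xs :=
  let m := nth 0 xs 0 in let n := nth 0 xs 1 in let k := nth 0 xs 2 in
  2 ^ (track m n k (0 + m * n - t.+1)).+1 * (y + y).+1.
apply: (@computable_ext _ (fun xs => iteri (nth 0 xs 0 * nth 0 xs 1) (fun t y => body t y xs) 0)).
  move=> xs _; rewrite /matrix_code /CodeSeq.code foldr_map -(iteri_foldr 0).
  by apply: eq_iteri => t y; rewrite /body addnn.
apply: (computable_iteri (body := body)); rewrite /body; computable.
by apply: computable_app4 computable4_track; computable.
Qed.

(** Unbounded search for the least word whose matrix has code [C], followed by the translation of
    that word into rotation codes. *)
Lemma search_program : exists alg, forall m n C k, matrix_code m n k = C ->
  (forall j, j < k -> matrix_code m n j != C) -> eval alg [:: m; n; C] (output_code m n k).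
Proof.
(* This function vanishes exactly on success; the word is its first argument because [Mu] searches
   there. *)
have [p pP] : computable 4 (fun xs =>
    1 - (matrix_code (nth 0 xs 1) (nth 0 xs 2) (nth 0 xs 0) == nth 0 xs 3)).
  computable; apply: computable_app3 computable3_matrix_code; computable.
have [q qP] := computable3_output_code.
exists (CompFun q [:: Proj 0; Proj 1; Mu p]) => m n C k ek min_k.
apply: (eval_CompFun (ys := [:: m; n; k])); last exact: (qP [:: m; n; k]).
do 2 (apply: evals_cons; first exact: (@eval_Proj _ [:: m; n; C])).
(* Before the first success the value is 1, the successor of [v j]. *)
apply: evals_cons (evals_nil _); apply: (eval_Mu (v := fun=> 0)) => [j lt_j|].
  by have := pP [:: j; m; n; C] erefl; rewrite /= (negPf (min_k _ lt_j)).
by have := pP [:: k; m; n; C] erefl; rewrite /= ek eqxx.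
Qed.

(** * Permutations *)

Import GroupScope.

Section PermFactorization.

Variable T : finType.
Implicit Types (p f : {perm T}) (x : T).

Definition cycle_root p x := froot p x.
Definition cycle_index p x := findex p (cycle_root p x) x.

Lemma cycle_rootX p k x : cycle_root p ((p ^+ k) x) = cycle_root p x.
Proof.
apply/eqP; rewrite /cycle_root root_connect ?permX; last exact/fconnect_sym/perm_inj.
by rewrite fconnect_sym ?fconnect_iter //; exact: perm_inj.
Qed.

Lemma cycle_indexK p x : (p ^+ cycle_index p x) (cycle_root p x) = x.
Proof.
rewrite permX iter_findex // fconnect_sym; last exact: perm_inj.
exact: connect_root.
Qed.

(* On the cycle with root r this maps p^k r to p^-k r. *)
Definition reflect_cycles p x := ((p ^+ cycle_index p x)^-1 (cycle_root p x)).

(** The reflection does not depend on the exponent: the formula holds for every [k], not only for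
    the one chosen by [cycle_index]. *)
Lemma reflect_cyclesX p k x :
  reflect_cycles p ((p ^+ k) (cycle_root p x)) = (p ^+ k)^-1 (cycle_root p x).
Proof.
rewrite /reflect_cycles; set r := cycle_root p x; set y := (p ^+ k) r.
have ry : cycle_root p y = r.
  by rewrite /y cycle_rootX /r /cycle_root root_root //; exact/fconnect_sym/perm_inj.
have := cycle_indexK p y; rewrite ry {1}/y => e.
apply: (@perm_inj _ (p ^+ cycle_index p y)); rewrite permKV.
apply: (@perm_inj _ (p ^+ k)); rewrite -!permM.
by rewrite -expgD addnC expgD mulgA mulVg mul1g.
Qed.

Lemma perm_expV p k : exists l, (p ^+ k)^-1 = p ^+ l.
Proof. by exists (#[p ^+ k].-1 * k)%N; rewrite invg_expg mulnC expgM. Qed.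

Lemma reflect_cyclesK p : involutive (reflect_cycles p).
Proof.
move=> x; rewrite {2}/reflect_cycles.
have [l el] := perm_expV p (cycle_index p x).
by rewrite el reflect_cyclesX -el invgK cycle_indexK.
Qed.

(** On each cycle [p] is a rotation, hence a product of two reflections: [f] sends [p ^+ k] of the
    root to its inverse power, and [f * p] reflects about a shifted centre. *)
Lemma perm_two_involutions p :
  exists f g, [/\ p = f * g, f * f = 1 & g * g = 1].
Proof.
pose f := perm (can_inj (reflect_cyclesK p)).
have ff : f * f = 1 by apply/permP => x; rewrite permM !permE reflect_cyclesK.
exists f, (f * p); split=> //; first by rewrite mulgA ff mul1g.
apply/permP => x; rewrite !permM perm1 !permE.
have [l el] := perm_expV p (cycle_index p x).
rewrite {2}/reflect_cycles el -permM -expgSr reflect_cyclesX.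
apply: (@perm_inj _ (p ^+ l)); rewrite -!permM.
by rewrite -expgS mulVg perm1 -el -{3}(cycle_indexK p x) permK.
Qed.

Definition moved p := [set x | p x != x].

Lemma perm_onS (A B : {set T}) p : A \subset B -> perm_on A p -> perm_on B p.
Proof. by move=> sAB sA; apply: subset_trans sAB. Qed.

Lemma involution_tpermM f x :
  f * f = 1 -> f x != x ->
  [/\ (f * tperm x (f x)) * (f * tperm x (f x)) = 1,
      moved (f * tperm x (f x)) = moved f :\ x :\ f x
    & f x \in moved f].
Proof.
move=> ff fx; have fK y : f (f y) = y by rewrite -permM ff perm1.
have tfx : tperm x (f x) ^ f = tperm x (f x) by rewrite tpermJ fK tpermC.
have ct : tperm x (f x) * f = f * tperm x (f x) by rewrite conjgC tfx.
split.
- by rewrite mulgA -(mulgA f) ct mulgA ff mul1g tperm2.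
- apply/setP => y; rewrite !inE permM.
  case: tpermP => [e | e | /eqP n1 /eqP n2].
  + by have -> : y = f x; rewrite ?eqxx // -e fK.
  + by rewrite (perm_inj e) eqxx andbF.
  + case: (y =P x) => [e|_]; first by rewrite e eqxx in n2.
    by case: (y =P f x) => [e|_] //; rewrite e fK eqxx in n1.
- by rewrite inE fK eq_sym.
Qed.

(** Serves to merge commutators of permutations with disjoint supports into a single one. *)
Lemma commgM_commute (G : groupType) (a b c d : G) :
  commute a c -> commute a d -> commute b c -> commute b d ->
  [~ a * c, b * d] = [~ a, b] * [~ c, d].
Proof.
move=> ac ad bc bd.
have conj_id (x y : G) : commute x y -> x ^ y = x by move=> xy; rewrite conjgE xy mulKg.
have comm_conj (x y z : G) : commute x y -> commute x z -> commute x (y ^ z).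
  by move=> xy xz; rewrite conjgE; do !apply: commuteM => //; exact: commuteV.
have cab : commute c^-1 (a ^ b).
  by apply/commute_sym/commuteV/commute_sym/comm_conj; apply/commute_sym.
have dab : commute (a ^ b) d by apply/commute_sym/comm_conj; apply/commute_sym.
have cV : commute c^-1 a^-1 by apply/commuteV/commute_sym/commuteV.
have {}bc : c ^ b = c by apply: conj_id; exact: commute_sym.
have comE (x y : G) : [~ x, y] = x^-1 * x ^ y by rewrite /commg /conjg !mulgA.
rewrite !comE invMg conjMg !conjgM (conj_id (a ^ b)) // bc.
move: (a ^ b) (c ^ d) cab => u w cu.
by rewrite !mulgA cV -!mulgA (mulgA c^-1 u) cu !mulgA.
Qed.

Definition id_or_tperm (t : {perm T}) := t = 1 \/ exists2 xy, xy.1 != xy.2 & t = tperm xy.1 xy.2.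

(** The 2-cycles are removed two at a time: a product of two disjoint transpositions is a commutator
    on their four points, and it merges with the commutator for the rest. At most one 2-cycle is
    left over as [t]. The supports are recorded so that the pieces commute in the induction. *)
Lemma involution_commutator f : f * f = 1 ->
  exists a b t, [/\ f = [~ a, b] * t, perm_on (moved f) a, perm_on (moved f) b,
                   perm_on (moved f) t & id_or_tperm t].
Proof.
have [k] := ubnP #|moved f|; elim: k f => // k IH f le_k ff.
have fK y : f (f y) = y by rewrite -permM ff perm1.
have [f1 | /eqP/permP f1] := eqVneq f 1.
  by exists 1, 1, 1; rewrite f1 commg1 mulg1 perm_on1; split=> //; left.
have [x fx] : exists x, f x != x.
  apply/existsP; apply: contra_notT f1 => /existsPn nf x.
  by have := nf x; rewrite negbK perm1 => /eqP.
have [gg mg mfx] := involution_tpermM ff fx; set g := f * _ in gg mg.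
have ef : f = g * tperm x (f x) by rewrite /g -mulgA tperm2 mulg1.
have mx : x \in moved f by rewrite inE.
have s2 : perm_on (moved f) (tperm x (f x)).
  by apply: perm_onS (tperm_on _ _); apply/subsetP => z /set2P[] ->.
have [g1 | /eqP/permP g1] := eqVneq g 1.
  exists 1, 1, (tperm x (f x)); rewrite commg1 mul1g !perm_on1; split=> //.
    by rewrite {1}ef g1 mul1g.
  by right; exists (x, f x) => //=; rewrite eq_sym.
have [w gw] : exists w, g w != w.
  apply/existsP; apply: contra_notT g1 => /existsPn ng z.
  by have := ng z; rewrite negbK perm1 => /eqP.
have [hh mh mgw] := involution_tpermM gg gw; set h := g * _ in hh mh.
have mw : w \in moved g by rewrite inE.
have := mw; rewrite mg !inE => /and3P[wfx wx fw].
have fwx : f w != x by rewrite -(inj_eq (@perm_inj _ f)) fK.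
have fwfx : f w != f x by rewrite (inj_eq (@perm_inj _ f)).
have egw : g w = f w by rewrite /g permM tpermD // eq_sym.
have sh : moved h \subset moved f.
  by rewrite mh mg; apply/subsetP => z; rewrite !inE => /and5P[].
have lt_h : #|moved h| < k.
  rewrite -ltnS (leq_trans _ le_k) // ltnS; apply/proper_card/properP; split=> //.
  by exists x => //; rewrite mh mg !inE eqxx !andbF.
have [a [b [t [eh sa sb st it]]]] := IH _ lt_h hh.
(* Conjugation by [v] turns [u] into the other 2-cycle [tperm w (f w)], so [[~ u, v]] is the product
   of the two. *)
pose u := tperm x (f x); pose v := tperm x w * tperm (f x) (f w).
pose D := [set x; f x; w; f w].
have disj : [disjoint moved h & D].
  rewrite disjoint_sym disjoints_subset; apply/subsetP => z.
  by rewrite mh mg egw !inE -!orbA => /or4P[] /eqP->; rewrite eqxx ?andbF.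
have Du : perm_on D u.
  by apply: perm_onS (tperm_on _ _); apply/subsetP => z /set2P[] ->; rewrite !inE eqxx ?orbT.
have Dv : perm_on D v.
  by apply: perm_onM; apply: perm_onS (tperm_on _ _); apply/subsetP => z /set2P[] ->; rewrite !inE eqxx ?orbT.
have comm s r : perm_on (moved h) s -> perm_on D r -> commute s r.
  by move=> ss sr; apply: perm_onC ss sr disj.
have fxw : f x != w by rewrite eq_sym.
have vx : v x = w by rewrite permM tpermL tpermD.
have vfx : v (f x) = f w 
  by rewrite permM [tperm x w _]tpermD ?tpermL //; rewrite eq_sym.
have uv : [~ u, v] = tperm w (f w) * u.
  have -> : [~ u, v] = u * u ^ v by rewrite /commg /conjg !mulgA tpermV.
  rewrite {2}/u tpermJ vx vfx; apply: (perm_onC (tperm_on _ _) (tperm_on _ _)).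
  rewrite disjoints_subset; apply/subsetP => z /set2P[] ->.
    by rewrite !inE negb_or eq_sym wx eq_sym fwx.
  by rewrite !inE negb_or fxw eq_sym fwfx.
have sD : D \subset moved f.
  by apply/subsetP => z; rewrite !inE -!orbA => /or4P[] /eqP->; rewrite ?fK // eq_sym.
exists (a * u), (b * v), t; split=> //.
- rewrite commgM_commute; try exact: comm.
  rewrite uv -mulgA (_ : _ * _ * t = t * (tperm w (f w) * u)).
    by rewrite mulgA -eh /h egw mulgA -(mulgA g) tperm2 mulg1 -ef.
  apply/esym/comm => //; apply: perm_onM => //.
  by apply: perm_onS (tperm_on _ _); apply/subsetP => z /set2P[] ->; rewrite !inE eqxx ?orbT.
- by apply: perm_onM; [apply: perm_onS sa | apply: perm_onS Du].
- by apply: perm_onM; [apply: perm_onS sb | apply: perm_onS Dv].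
- exact: perm_onS st.
Qed.

Lemma tperm_pair_commutator (x y x' y' : T) :
  x != y -> x' != y' -> exists g, tperm x y * tperm x' y' = [~ tperm x y, g].
Proof.
(* [g] sends [x] to [x'] and [y] to [y'], so it conjugates the first transposition into the
   second. *)
move=> xy xy'; pose g := tperm x x' * tperm (tperm x x' y) y'.
exists g; rewrite /commg tpermV; congr (_ * _).
rewrite tpermJ /g !permM tpermL.
rewrite [tperm (tperm x x' y) y' x']tpermD; first by rewrite tpermL.
  by rewrite -{2}(tpermL x x') (inj_eq perm_inj) eq_sym.
by rewrite eq_sym.
Qed.

Lemma odd_commg (a b : {perm T}) : odd_perm [~ a, b] = false.
Proof. by rewrite /commg !odd_permM !odd_permV; do 2 case: odd_perm. Qed.

(** Each of two involutions with product [p] is a commutator up to a factor [t] or [s]. Moving [t]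
    to the right conjugates the second commutator; by parity [t * s] is 1 or a product of two
    transpositions, which gives the third. *)
Lemma even_perm_commutators p : ~~ odd_perm p ->
  exists a b c d e f, p = [~ a, b] * [~ c, d] * [~ e, f].
Proof.
move=> ev; have [f [g [ep ff gg]]] := perm_two_involutions p.
have [a [b [t [ef _ _ _ it]]]] := involution_commutator ff.
have [c [d [s [eg _ _ _ is_]]]] := involution_commutator gg.
have e : p = [~ a, b] * [~ c ^ t^-1, d ^ t^-1] * (t * s).
  by rewrite ep ef eg -conjRg /conjg invgK !mulgA mulgKV.
exists a, b, (c ^ t^-1), (d ^ t^-1); rewrite e.
have [e' [f' ->]] : exists e' f', t * s = [~ e', f']; last by exists e', f'.
move: ev; rewrite e 2!odd_permM (odd_commg a) (odd_commg (c ^ _)) odd_permM /=.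
case: it is_ => [->|[[x y] /= xy ->]] [->|[[x' y'] /= xy' ->]].
- by exists 1, 1; rewrite commg1 mulg1.
- by rewrite odd_perm1 odd_tperm xy'.
- by rewrite odd_perm1 odd_tperm xy.
- by have [h ->] := tperm_pair_commutator xy xy'; exists (tperm x y), h.
Qed.

End PermFactorization.

(** * Short words in the rotations *)

Section LineActions.

Variables X Y : finType.

Definition rows_fun (g : X -> {perm Y}) (p : X * Y) := (p.1, g p.1 p.2).
Lemma rows_fun_inj g : injective (rows_fun g).
Proof. by move=> [x y] [x' y'] [<- /perm_inj <-]. Qed.
Definition rows_act g := perm (@rows_fun_inj g).
Definition row_act x (f : {perm Y}) := rows_act (fun z => if z == x then f else 1).

Definition cols_fun (g : Y -> {perm X}) (p : X * Y) := (g p.2 p.1, p.2).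
Lemma cols_fun_inj g : injective (cols_fun g).
Proof. by move=> [x y] [x' y'] [] /[swap] <- /perm_inj <-. Qed.
Definition cols_act g := perm (@cols_fun_inj g).
Definition col_act y (f : {perm X}) := cols_act (fun z => if z == y then f else 1).

Lemma rows_actE g p : rows_act g p = (p.1, g p.1 p.2).
Proof. by rewrite permE. Qed.

Lemma cols_actE g p : cols_act g p = (g p.2 p.1, p.2).
Proof. by rewrite permE. Qed.

Lemma rows_actM g h : rows_act g * rows_act h = rows_act (fun x => g x * h x).
Proof. by apply/permP => p; rewrite permM !rows_actE permM. Qed.

Lemma cols_actM g h : cols_act g * cols_act h = cols_act (fun x => g x * h x).
Proof. by apply/permP => p; rewrite permM !cols_actE permM. Qed.

Lemma eq_rows_act g h : g =1 h -> rows_act g = rows_act h.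
Proof. by move=> gh; apply/permP => p; rewrite !rows_actE gh. Qed.

Lemma eq_cols_act g h : g =1 h -> cols_act g = cols_act h.
Proof. by move=> gh; apply/permP => p; rewrite !cols_actE gh. Qed.

Lemma rows_act1 g : (forall x, g x = 1) -> rows_act g = 1.
Proof. by move=> g1; apply/permP => -[x y]; rewrite rows_actE g1 !perm1. Qed.

Lemma cols_act1 g : (forall y, g y = 1) -> cols_act g = 1.
Proof. by move=> g1; apply/permP => -[x y]; rewrite cols_actE g1 !perm1. Qed.

Lemma cols_actX f k : cols_act (fun=> f) ^+ k = cols_act (fun=> f ^+ k).
Proof.
elim: k => [|k IH]; first by rewrite expg0 cols_act1.
by rewrite expgS IH cols_actM; apply: eq_cols_act => y; rewrite expgS.
Qed.

Lemma row_actM x f g : row_act x f * row_act x g = row_act x (f * g).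
Proof. by rewrite rows_actM; apply: eq_rows_act => z /=; case: eqP; rewrite ?mulg1. Qed.

Lemma row_act1 x : row_act x 1 = 1.
Proof. by apply: rows_act1 => z; case: eqP. Qed.

Lemma row_actV x f : row_act x f^-1 = (row_act x f)^-1.
Proof. by apply: (mulgI (row_act x f)); rewrite row_actM !mulgV row_act1. Qed.

Lemma row_actX x f k : row_act x f ^+ k = row_act x (f ^+ k).
Proof.
by elim: k => [|k IH]; [rewrite !expg0 row_act1 | rewrite !expgS IH row_actM].
Qed.

Lemma row_act_tperm x y y' : row_act x (tperm y y') = tperm (x, y) (x, y').
Proof.
apply/permP => -[z w]; rewrite rows_actE /=; have [->|zx] := eqVneq z x; last first.
  by rewrite perm1 tpermD // xpair_eqE eq_sym (negPf zx).
by case: tpermP => [->|->|/eqP wy /eqP wy']; rewrite ?tpermL ?tpermR // tpermD // xpair_eqE eqxx eq_sym.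
Qed.

Lemma odd_row_act x f : odd_perm (row_act x f) = odd_perm f.
Proof.
case: (prod_tpermP f) => ts -> /allP dts.
elim: ts dts => [|[y y'] ts IH] dts; first by rewrite big_nil row_act1 !odd_perm1.
rewrite big_cons -row_actM odd_permM row_act_tperm odd_tperm xpair_eqE eqxx /=.
by rewrite odd_mul_tperm IH // => t tts; apply: dts; rewrite inE tts orbT.
Qed.

End LineActions.

(** Lets an arbitrary permutation of a row be replaced by a power of its rotation when a column
    shift is conjugated: the column meets the row in one cell only. *)
Lemma conj_eq_moved (T : finType) (s u v : {perm T}) :
  (forall x, s x != x -> u x = v x) -> s ^ u = s ^ v.
Proof.
move=> uv; apply/permP => z; rewrite -[z](permKV u); set x := u^-1 z; rewrite permJ.
have [sx | sx] := eqVneq (s x) x; last first.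
  by rewrite (uv _ sx) permJ uv // (inj_eq (@perm_inj _ s)).
rewrite sx -{2}[u x](permKV v) permJ; set w := v^-1 _.
have [-> | sw] := eqVneq (s w) w; first by rewrite /w permKV.
have : u w = u x by rewrite uv // /w permKV.
by move/perm_inj => wx; rewrite wx sx eqxx in sw.
Qed.

Section Words.

Variables X Y : finType.
Variables (a : {perm X}) (b : {perm Y}).

Definition generator (r : X + Y) : {perm X * Y} :=
  match r with inl x => row_act x b | inr y => col_act y a end.

(** The words contain no inverse generators, in accordance with the rotations allowed in the
    output. *)
Definition reach k (s : {perm X * Y}) :=
  exists2 w, size w <= k & s = \prod_(r <- w) generator r.

Lemma reachM j k s t : reach j s -> reach k t -> reach (j + k) (s * t).
Proof.
move=> [v vj ->] [w wk ->]; exists (v ++ w); last by rewrite big_cat.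
by rewrite size_cat leq_add.
Qed.

Lemma reachW j k s : j <= k -> reach j s -> reach k s.
Proof. by move=> jk [w wj ->]; exists w => //; apply: leq_trans jk. Qed.

Lemma reach1 k : reach k 1.
Proof. by exists [::]; rewrite // big_nil. Qed.

Lemma reach_generator r : reach 1 (generator r).
Proof. by exists [:: r]; rewrite // big_seq1. Qed.

Lemma reachX j k s : reach j s -> reach (k * j) (s ^+ k).
Proof.
by move=> rs; elim: k => [|k IH]; [exact: reach1 | rewrite mulSn expgS; exact: reachM].
Qed.

End Words.

(** [a] is one cycle through all of [X]. Stating this abstractly lets rows and columns be
    exchanged. *)
Record cyclic (X : finType) (a : {perm X}) : Prop := Cyclic {
  cyclic_order : a ^+ #|X| = 1;
  cyclic_trans : forall x y, exists2 k, k < #|X| & (a ^+ k) x = y;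
  cyclic_free : forall x k, 0 < k < #|X| -> (a ^+ k) x != x }.

(** * Permuting all rows but one in parallel *)

Section RowSorting.

Variables X Y : finType.
Variables (a : {perm X}) (b : {perm Y}).
Hypotheses (cyc_a : cyclic a) (cyc_b : cyclic b).

Local Notation reach := (reach a b).
Local Notation down := (cols_act (fun _ : Y => a)).

Lemma prod_col_act (ys : seq Y) : uniq ys ->
  \prod_(y <- ys) col_act y a = cols_act (fun y => if y \in ys then a else 1).
Proof.
elim: ys => [|y ys IH] /=; first by rewrite big_nil cols_act1.
case/andP => yys /IH; rewrite big_cons => ->; rewrite cols_actM.
apply: eq_cols_act => z; rewrite inE.
by case: eqP => [->|_] /=; rewrite ?(negPf yys) ?mulg1 ?mul1g.
Qed.

(* While row x turns K times, column y is moved when K - k y turns are done. *)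
Lemma reach_interleave x (k : Y -> nat) K ys :
  path geq K [seq k y | y <- ys] ->
  reach (K + size ys) (row_act x b ^+ K * \prod_(y <- ys) col_act y a ^ (row_act x b ^+ k y)).
Proof.
elim: ys K => [|y ys IH] K /=.
  move=> _; rewrite big_nil mulg1 addn0 -{1}(muln1 K); apply: reachX.
  exact: (reach_generator _ _ (inl x)).
case/andP => kyK /IH rys; rewrite big_cons conjgE.
set R := row_act x b; set P := \prod_(z <- ys) _.
have -> : R ^+ K * (R ^- k y * (col_act y a * R ^+ k y) * P) =
          R ^+ (K - k y) * col_act y a * (R ^+ k y * P).
  by rewrite -{1}(subnK kyK) expgD !mulgA mulgK.
apply: (@reachW _ _ _ _ ((K - k y) * 1 + 1 + (k y + size ys))); first by move: kyK; rewrite /geq /=; lia.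
apply: reachM => //; apply: reachM; first exact/reachX/(reach_generator _ _ (inl x)).
exact: (reach_generator _ _ (inr y)).
Qed.

(** Choose [k y] with [b ^+ k y] sending [y] to [f y]. Taken by decreasing [k y], the columns are
    all served during one full turn of row [x]: [#|Y|] turns and [#|Y|] column moves. *)
Lemma reach_conj_down x f : reach (2 * #|Y|) (down ^ row_act x f).
Proof.
have [k kP] : exists k : Y -> nat, forall y, k y < #|Y| /\ (b ^+ k y) y = f y.
  apply: (fin_all_exists (P := fun y i => i < #|Y| /\ (b ^+ i) y = f y)) => y.
  by have [k kY ky] := cyclic_trans cyc_b y (f y); exists k.
pose ys := sort (fun y z => k y >= k z) (enum Y).
have uys : uniq ys by rewrite sort_uniq enum_uniq.
have -> : down = \prod_(y <- ys) col_act y a.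
  by rewrite prod_col_act //; apply: eq_cols_act => y; rewrite mem_sort mem_enum.
have -> : (\prod_(y <- ys) col_act y a) ^ row_act x f =
          row_act x b ^+ #|Y| * \prod_(y <- ys) col_act y a ^ (row_act x b ^+ k y).
  rewrite row_actX (cyclic_order cyc_b) row_act1 mul1g.
  rewrite (big_morph (fun s => s ^ _) (fun s t => conjMg s t _) (conj1g _)).
  apply: eq_bigr => y _; apply: conj_eq_moved => -[x' y'].
  rewrite cols_actE /=; have [-> _|_] := eqVneq y' y; last by rewrite perm1 eqxx.
  by rewrite row_actX !rows_actE /=; case: eqP; rewrite // (proj2 (kP y)).
apply: (@reachW _ _ _ _ (#|Y| + size ys)).
  by rewrite size_sort -cardE mul2n addnn.
apply: reach_interleave; rewrite path_min_sorted.
  rewrite sorted_map; apply: sort_sorted => y z; exact: leq_total.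
by apply/allP => _ /mapP[y _ ->]; exact/ltnW/(proj1 (kP y)).
Qed.

Lemma down_rows g k :
  down ^+ k * rows_act g = rows_act (fun x => g ((a ^+ k) x)) * down ^+ k.
Proof. by apply/permP => p; rewrite cols_actX !permM !rows_actE !cols_actE. Qed.

Lemma down_order : down ^+ #|X| = 1.
Proof. by rewrite cols_actX (cyclic_order cyc_a) cols_act1. Qed.

Hypothesis X_gt1 : 1 < #|X|.

(* Step t + 1 of the induction corrects the row [x] with [a^t x = x1], at the
   price of disturbing the next one; only the last row is left wrong. *)
Lemma reach_rows_but_one x0 (g : X -> {perm Y}) :
  exists2 h, reach (2 * (#|X| * #|Y|)) (rows_act h) & forall x, x != x0 -> h x = g x.
Proof.
have cX0 : 0 < #|X| by exact: ltnW.
(* The row left wrong is the one that needs [#|X|.-1] shifts to arrive at [x1]; this choice makes it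
   [x0]. *)
pose x1 := a^-1 x0.
have claim t : t < #|X| -> exists2 h, reach (t * (2 * #|Y|)) (rows_act h * down ^+ t) &
    forall x i, i < t -> (a ^+ i) x = x1 -> h x = g x.
  elim: t => [|t IH] ltX.
    by exists (fun=> 1) => //; rewrite rows_act1 // mulg1; exact: reach1.
  have [h rh hg] := IH (ltnW ltX); pose xt := (a ^+ t)^-1 x1.
  (* The conjugated shift applies [f^-1] to the row now at [x1], which turns [h xt] into [g xt], and
     [f] to the row that arrives there next. *)
  pose f := (g xt)^-1 * h xt.
  exists (fun x => h x * ((if (a ^+ t) x == x1 then f^-1 else 1) *
                         (if (a ^+ t.+1) x == x1 then f else 1))).
    have := reachM rh (reach_conj_down x1 f); rewrite mulSn addnC.
    congr (reach _ _); rewrite conjgE -row_actV !mulgA -(mulgA (rows_act h)) down_rows.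
    rewrite !mulgA -(mulgA _ (down ^+ t)) -expgSr -mulgA down_rows !mulgA.
    by congr (_ * _); rewrite !rows_actM; apply: eq_rows_act => x; rewrite mulgA.
  (* No row comes back to [x1] within fewer than [#|X|] shifts, so corrected rows stay correct. *)
  have away x i j : (a ^+ i) x = x1 -> i < j <= t.+1 -> (a ^+ j) x != x1.
    move=> ax ij; rewrite -(subnKC (ltnW (proj1 (andP ij)))) expgD permM ax.
    by apply: (cyclic_free cyc_a); lia.
  move=> x i; rewrite ltnS leq_eqVlt => /predU1P[-> ax|it ax].
    rewrite ax eqxx (negPf (away _ _ _ ax _)) ?ltnSn // mulg1.
    by have -> : x = xt; [rewrite /xt -ax permK | rewrite /f invMg invgK mulKVg].
  rewrite (negPf (away _ _ t ax _)) ?(negPf (away _ _ t.+1 ax _)) ?mulg1; try lia.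
  exact: hg ax.
have [h rh hg] := claim #|X|.-1 (etrans (congr1 (leq^~ _) (prednK cX0)) (leqnn _)).
(* A last plain shift completes the full turn, so the shifts cancel. *)
have rd := reach_conj_down x1 1; rewrite row_act1 conjg1 in rd.
exists h.
  have := reachM rh rd; rewrite -mulgA -expgSr prednK // down_order mulg1.
  by apply: reachW; rewrite -mulSnr prednK // mulnCA.
move=> x xx0; have [i iX ax] := cyclic_trans cyc_a x x1.
apply: (hg _ i) (ax); rewrite ltn_neqAle -ltnS prednK // iX andbT.
apply: contraNneq xx0 => ei.
have : (a ^+ #|X|) x = x0 by rewrite -(prednK cX0) expgSr permM -ei ax permKV.
by rewrite (cyclic_order cyc_a) perm1 => ->.
Qed.

End RowSorting.

Section ReachN.

Variables X Y : finType.
Variables (a : {perm X}) (b : {perm Y}).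

Definition reachN k (s : {perm X * Y}) := reach a b (k * (#|X| * #|Y|)) s.

Lemma reachNM j k s t : reachN j s -> reachN k t -> reachN (j + k) (s * t).
Proof. by rewrite /reachN mulnDl; apply: reachM. Qed.

Lemma reachNW j k s : j <= k -> reachN j s -> reachN k s.
Proof. by move=> jk; apply: reachW; rewrite leq_mul2r jk orbT. Qed.

End ReachN.

(** * Exchanging rows and columns *)

Section Transpose.

Variables X Y : finType.

Definition swap_fun (s : {perm X * Y}) (p : Y * X) :=
  ((s (p.2, p.1)).2, (s (p.2, p.1)).1).

Lemma swap_fun_inj s : injective (swap_fun s).
Proof.
move=> [y x] [y' x']; rewrite /swap_fun /= => -[e2 e1].
have : s (x, y) = s (x', y') by apply/eqP; rewrite -pair_eqE /= e1 e2 !eqxx.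
by move/perm_inj => [-> ->].
Qed.

Definition swap_perm s := perm (@swap_fun_inj s).

Lemma swap_permE s y x : swap_perm s (y, x) = ((s (x, y)).2, (s (x, y)).1).
Proof. by rewrite permE. Qed.

Lemma swap_permM s t : swap_perm (s * t) = swap_perm s * swap_perm t.
Proof.
apply/permP => -[y x]; rewrite permM !swap_permE permM.
by case: (s _).
Qed.

Lemma swap_perm1 : swap_perm 1 = 1.
Proof. by apply/permP => -[y x]; rewrite swap_permE !perm1. Qed.

Lemma swap_permV s : swap_perm s^-1 = (swap_perm s)^-1.
Proof. by apply: (mulgI (swap_perm s)); rewrite -swap_permM !mulgV swap_perm1. Qed.

Lemma swap_rows_act g : swap_perm (rows_act g) = cols_act g.
Proof. by apply/permP => -[y x]; rewrite swap_permE rows_actE cols_actE. Qed.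

Lemma swap_cols_act g : swap_perm (cols_act g) = rows_act g.
Proof. by apply/permP => -[y x]; rewrite swap_permE rows_actE cols_actE. Qed.

Lemma swap_tperm x y x' y' :
  swap_perm (tperm (x, y) (x', y')) = tperm (y, x) (y', x').
Proof.
apply/permP => -[w z]; rewrite swap_permE.
case: tpermP => [[-> ->]|[-> ->]|/eqP n1 /eqP n2]; rewrite ?tpermL ?tpermR //=.
by rewrite tpermD // xpair_eqE andbC -xpair_eqE eq_sym.
Qed.

Lemma odd_swap_perm s : odd_perm (swap_perm s) = odd_perm s.
Proof.
case: (prod_tpermP s) => ts -> /allP dts.
elim: ts dts => [|[[x y] [x' y']] ts IH] dts; first by rewrite big_nil swap_perm1 !odd_perm1.
rewrite big_cons swap_permM swap_tperm !odd_mul_tperm !xpair_eqE andbC IH //.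
by move=> t tts; apply: dts; rewrite inE tts orbT.
Qed.

Lemma reach_swap a b k s : reach a b k s -> reach b a k (swap_perm s).
Proof.
move=> [w wk ->]; exists [seq match r with inl x => inr x | inr y => inl y end | r <- w].
  by rewrite size_map.
rewrite big_map (big_morph swap_perm swap_permM swap_perm1).
by apply: eq_bigr => -[x|y] _; rewrite ?swap_rows_act ?swap_cols_act.
Qed.

Lemma reachN_swap a b k s : reachN a b k s -> reachN b a k (swap_perm s).
Proof. by rewrite /reachN (mulnC #|Y|); apply: reach_swap. Qed.

End Transpose.

(** When the supports meet in [p] alone, the commutator is the 3-cycle on [p], [u p] and [v p],
    written here as two transpositions. *)
Lemma commg_single_moved (T : finType) (u v : {perm T}) p :
  (forall q, u q != q -> v q != q -> q = p) -> u p != p -> v p != p ->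
  [~ u, v] = tperm p (v p) * tperm p (u p).
Proof.
move=> uv up vp.
have uI := inj_eq (@perm_inj _ u); have vI := inj_eq (@perm_inj _ v).
have fixu q : v q != q -> q != p -> u q = q.
  by move=> vq qp; apply: contraNeq qp => uq; apply/eqP/uv.
have fixv q : u q != q -> q != p -> v q = q.
  by move=> uq qp; apply: contraNeq qp => vq; apply/eqP/uv.
have uvp : u (v p) = v p by rewrite fixu // vI.
have vup : v (u p) = u p by rewrite fixv // uI.
have upvp : u p != v p by apply: contraNneq up => e; rewrite -uI {1}e uvp e.
suff e : v * u * (tperm p (v p) * tperm p (u p)) = u * v.
  by rewrite /commg conjgE -e -!mulgA !mulKg.
apply/permP => z; rewrite !permM.
have [->|zp] := eqVneq z p; first by rewrite uvp tpermR tpermL.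
have [uz|uz] := eqVneq (u z) z; last first.
  rewrite (fixv z) //; have [->|uzp] := eqVneq (u z) p.
    by rewrite tpermL tpermD // eq_sym.
  rewrite (fixv (u z)) ?uI // [tperm p (v p) _]tpermD 1?eq_sym //; last first.
    by apply: contraNneq vp => e; rewrite -vI -e fixv // uI.
  by rewrite tpermD 1?eq_sym // uI.
rewrite uz; have [->|vzp] := eqVneq (v z) p; first by rewrite [tperm p (v p) _]tpermD ?tpermR // eq_sym.
have -> : u (v z) = v z.
  by have [->|vz] := eqVneq (v z) z; rewrite // fixu // vI.
rewrite [tperm p (v p) _]tpermD; [|by rewrite eq_sym|by rewrite vI eq_sym].
rewrite tpermD //; first by rewrite eq_sym.
apply: contraNneq up => e; rewrite -uI.
have ez : z = u p by apply: (@perm_inj _ v); rewrite vup.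
by rewrite -ez uz ez.
Qed.

Lemma reach_row_genV (X Y : finType) (a : {perm X}) (b : {perm Y}) (x : X) :
  cyclic b -> 0 < #|Y| -> reach a b #|Y|.-1 (row_act x b)^-1.
Proof.
move=> cyc_b Y_gt0; set R := row_act x b.
have -> : R^-1 = R ^+ #|Y|.-1.
  apply: (mulgI R); rewrite -expgS prednK ?mulgV //.
  by rewrite row_actX (cyclic_order cyc_b) row_act1.
by have := reachX #|Y|.-1 (reach_generator a b (inl x)); rewrite muln1.
Qed.

(** * Even permutations of a single row *)

Section CyclicRows.

Variables X Y : finType.
Variables (a : {perm X}) (b : {perm Y}).
Hypotheses (cyc_a : cyclic a) (cyc_b : cyclic b).
Hypotheses (X_gt1 : 1 < #|X|) (Y_gt1 : 1 < #|Y|).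

Local Notation reachN := (reachN a b).
Local Notation down := (cols_act (fun _ : Y => a)).

(** In [(down ^ row_act x f) ^+ k] the inner factors cancel, leaving [f^-1], then [k] shifts, then
    [f] on the row that has arrived at [x]. The remaining [#|X| - k] plain shifts complete the
    turn. *)
Lemma reachN_row_pair x x' f : reachN 2 (row_act x f^-1 * row_act x' f).
Proof.
have [k kX ak] := cyclic_trans cyc_a x' x.
have -> : row_act x f^-1 * row_act x' f = (down ^ row_act x f) ^+ k * down ^+ (#|X| - k).
  have -> : down ^+ (#|X| - k) = (down ^+ k)^-1.
    by apply: (mulgI (down ^+ k)); rewrite -expgD mulgV subnKC ?(down_order _ cyc_a) // ltnW.
  rewrite -conjXg conjgE -!mulgA (mulgA (down ^+ k)) down_rows mulgK row_actV.
  congr (_ * _); apply: eq_rows_act => z.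
  by rewrite -ak (inj_eq (@perm_inj _ _)).
have := reach_conj_down a cyc_b x 1; rewrite row_act1 conjg1 => rd.
have := reachM (reachX k (reach_conj_down a cyc_b x f)) (reachX (#|X| - k) rd).
by apply: reachW; rewrite -mulnDl subnKC ?(ltnW kX) // mulnCA.
Qed.

(** Three row pairs, for [f], [g] and [(f * g)^-1]: on an auxiliary row [x'] they cancel, while on
    [x] the inverses multiply to the commutator. *)
Lemma reachN_row_commutator x f g : reachN 6 (row_act x [~ f, g]).
Proof.
have [x' x'x] : exists x', x' != x.
  have : [set x] \proper [set: X] by rewrite properEcard subsetT cards1 cardsT.
  by case/properP => _ [x' _]; rewrite inE; exists x'.
have -> : row_act x [~ f, g] = (row_act x f^-1 * row_act x' f) *
    (row_act x g^-1 * row_act x' g) * (row_act x ((f * g)^-1)^-1 * row_act x' (f * g)^-1).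
  rewrite !rows_actM; apply: eq_rows_act => z; rewrite invgK invMg.
  have [->|zx] := eqVneq z x.
    by rewrite eq_sym (negPf x'x) !mulg1 /commg /conjg !mulgA.
  case: eqP => _; rewrite !mul1g ?mulg1 //.
  by rewrite -!mulgA mulKVg mulgV.
by apply: (@reachNM _ _ _ _ 4 2); [apply: (@reachNM _ _ _ _ 2 2)|]; exact: reachN_row_pair.
Qed.

Lemma reachN_row_even x f : ~~ odd_perm f -> reachN 18 (row_act x f).
Proof.
case/even_perm_commutators => c1 [c2 [c3 [c4 [c5 [c6 ->]]]]].
rewrite -(row_actM _ (_ * [~ c3, c4])) -(row_actM _ [~ c1, c2]).
apply: (@reachNM _ _ _ _ 12 6); last exact: reachN_row_commutator.
by apply: (@reachNM _ _ _ _ 6 6); exact: reachN_row_commutator.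
Qed.

Lemma reachN_rows_but_one x0 (g : X -> {perm Y}) :
  exists f, reachN 2 (rows_act g * row_act x0 f).
Proof.
have [h rh hg] := reach_rows_but_one cyc_a cyc_b X_gt1 x0 g.
exists ((g x0)^-1 * h x0); congr (reach _ _ _ _): rh; rewrite rows_actM.
by apply: eq_rows_act => x; case: eqP => [->|/eqP/hg ->]; rewrite ?mulKVg ?mulg1.
Qed.

End CyclicRows.

(** * Even column permutations and trading of transpositions *)

Section ColumnReach.

Variables X Y : finType.
Variables (a : {perm X}) (b : {perm Y}).
Hypotheses (cyc_a : cyclic a) (cyc_b : cyclic b).
Hypotheses (X_gt1 : 1 < #|X|) (Y_gt1 : 1 < #|Y|).

Local Notation reachN := (reachN a b).

Lemma reachN_col_even y f : ~~ odd_perm f -> reachN 18 (col_act y f).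
Proof.
by move=> ev; rewrite /col_act -swap_rows_act; apply: reachN_swap; exact: reachN_row_even.
Qed.

Lemma reachN_cols_but_one y0 (g : Y -> {perm X}) :
  exists f, reachN 2 (cols_act g * col_act y0 f).
Proof.
have [f rf] := reachN_rows_but_one cyc_b cyc_a Y_gt1 y0 g; exists f.
by rewrite /col_act -!swap_rows_act -swap_permM; apply: reachN_swap.
Qed.

(* For transpositions s and t: each can be traded for the other. *)
Definition near k s t := reachN k (s * t) /\ reachN k (t * s).

Lemma near_sym k s t : near k s t -> near k t s.
Proof. by case. Qed.

Lemma nearW j k s t : j <= k -> near j s t -> near k s t.
Proof. by move=> jk []; split; apply: reachNW jk _. Qed.

Lemma near_trans j k s t u : t * t = 1 -> near j s t -> near k t u -> near (j + k) s u.
Proof.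
move=> tt [st ts] [tu ut]; split.
  have -> : s * u = (s * t) * (t * u) by rewrite -mulgA (mulgA t) tt mul1g.
  exact: reachNM.
have -> : u * s = (u * t) * (t * s) by rewrite -mulgA (mulgA t) tt mul1g.
by rewrite addnC; apply: reachNM.
Qed.

(** A row pair carries the transposition from [x] to [x'] at cost 2; within [x'] two transpositions
    form an even permutation, at cost 18. *)
Lemma near_row_tperm x y y' x' z z' : y != y' -> z != z' ->
  near 20 (tperm (x, y) (x, y')) (tperm (x', z) (x', z')).
Proof.
move=> yy zz; rewrite -!row_act_tperm.
apply: (@near_trans 2 18 _ (row_act x' (tperm y y'))).
- by rewrite row_act_tperm tperm2.
- by split; rewrite -{1}(tpermV y y'); exact: reachN_row_pair.
- by split; rewrite row_actM; apply: reachN_row_even; rewrite // odd_permM !odd_tperm yy zz.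
Qed.

End ColumnReach.

(** * All permutations of the cells, up to one transposition *)

Section TorusReach.

Variables X Y : finType.
Variables (a : {perm X}) (b : {perm Y}).
Hypotheses (cyc_a : cyclic a) (cyc_b : cyclic b).
Hypotheses (X_gt1 : 1 < #|X|) (Y_gt1 : 1 < #|Y|).

Local Notation reachN := (reachN a b).
Local Notation near := (near a b).

Lemma near_col_tperm x x' y z z' y' : x != x' -> z != z' ->
  near 20 (tperm (x, y) (x', y)) (tperm (z, y') (z', y')).
Proof.
move=> xx zz; have [] := near_row_tperm cyc_b cyc_a Y_gt1 y y' xx zz.
by split; rewrite -(swap_tperm y) -(swap_tperm y') -swap_permM; apply: reachN_swap.
Qed.

(** Row [x] and column [y] share one cell, so the commutator of their rotations is the product of
    these two transpositions. Its length is [#|X| + #|Y|], at most [#|X| * #|Y|] as both are at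
    least 2. *)
Lemma near_corner x y : near 1 (tperm (x, y) (a x, y)) (tperm (x, y) (x, b y)).
Proof.
pose R := row_act x b; pose D := col_act y a.
have ax : a x != x by have := cyclic_free cyc_a x (k := 1); rewrite expg1; apply.
have by_ : b y != y by have := cyclic_free cyc_b y (k := 1); rewrite expg1; apply.
have Re : R (x, y) = (x, b y) by rewrite rows_actE /= eqxx.
have De : D (x, y) = (a x, y) by rewrite cols_actE /= eqxx.
have RD q : R q != q -> D q != q -> q = (x, y).
  case: q => x' y'; rewrite rows_actE cols_actE /=.
  have [->|] := eqVneq x' x; last by rewrite perm1 eqxx.
  by have [->|] := eqVneq y' y; last by rewrite perm1 eqxx.
have nR : R (x, y) != (x, y) by rewrite Re xpair_eqE eqxx.
have nD : D (x, y) != (x, y) by rewrite De xpair_eqE eqxx andbT.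
have VR : reach a b #|Y|.-1 R^-1 by apply: reach_row_genV (ltnW _).
have VD : reach a b #|X|.-1 D^-1.
  have := reach_swap (reach_row_genV b y cyc_a (ltnW X_gt1)).
  by rewrite swap_permV swap_rows_act.
have r1 r : reach a b 1 (generator a b r) by exact: reach_generator.
have bound : #|Y|.-1 + (#|X|.-1 + (1 + 1)) <= 1 * (#|X| * #|Y|) by nia.
split; rewrite -Re -De.
- rewrite -commg_single_moved //; apply: reachW bound _; rewrite /commg /conjg.
  by do 2!apply: reachM => //; apply: (reachM (r1 (inl x)) (r1 (inr y))).
- rewrite -commg_single_moved //; last by move=> q Dq Rq; exact: RD.
  apply: (@reachW _ _ _ _ (#|X|.-1 + (#|Y|.-1 + (1 + 1)))); first by move: bound; lia.
  rewrite /commg /conjg.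
  by do 2!apply: reachM => //; apply: (reachM (r1 (inr y)) (r1 (inl x))).
Qed.

Definition line_tperm (t : {perm X * Y}) :=
  (exists x y y', y != y' /\ t = tperm (x, y) (x, y')) \/
  (exists x x' y, x != x' /\ t = tperm (x, y) (x', y)).

Lemma near_line_tperm s t : line_tperm s -> line_tperm t -> near 41 s t.
Proof.
(* The two kinds are linked through the corner at [(x, y)]: 20 + 1 + 20. *)
have mixed x y y' z z' w : y != y' -> z != z' ->
    near 41 (tperm (x, y) (x, y')) (tperm (z, w) (z', w)).
  move=> yy zz.
  have ax : x != a x by rewrite eq_sym; have := cyclic_free cyc_a x (k := 1); rewrite expg1; apply.
  have by_ : y != b y by rewrite eq_sym; have := cyclic_free cyc_b y (k := 1); rewrite expg1; apply.
  apply: (near_trans (j := 20) (k := 21) (tperm2 _ _) (near_row_tperm _ _ _ x _ yy by_)) => //.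
  apply: (near_trans (j := 1) (k := 20) (tperm2 _ _) (near_sym (near_corner x y))).
  exact: near_col_tperm.
case=> [[x [y [y' [yy ->]]]]|[x [x' [y [xx ->]]]]] [[z [w [w' [ww ->]]]]|[z [z' [w [zz ->]]]]].
- by apply: (@nearW _ _ _ _ 20) => //; exact: near_row_tperm.
- exact: mixed.
- exact/near_sym/mixed.
- by apply: (@nearW _ _ _ _ 20) => //; exact: near_col_tperm.
Qed.

Lemma near_tperm p q t : p != q -> line_tperm t -> near 82 (tperm p q) t.
Proof.
case: p q => [x y] [x' y'] pq lt.
have [e|xx] := eqVneq x x'.
  rewrite -e xpair_eqE eqxx /= in pq *; apply: (@nearW _ _ _ _ 41) => //.
  by apply: near_line_tperm => //; left; exists x, y, y'.
have [e|yy] := eqVneq y y'.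
  rewrite -e in pq *; apply: (@nearW _ _ _ _ 41) => //.
  by apply: near_line_tperm => //; right; exists x, x', y.
pose r := (x, y').
have lr : line_tperm (tperm r (x', y')) by right; exists x, x', y'.
have lp : line_tperm (tperm (x, y) r) by left; exists x, y, y'.
apply: (near_trans (j := 41) (k := 41) (tperm2 r (x', y')) _ (near_line_tperm lr lt)).
(* A general transposition is a conjugate of one along row [x] by one along column [y']; its product
   with the latter is a product of two line transpositions. *)
have -> : tperm (x, y) (x', y') = tperm r (x', y') * (tperm (x, y) r * tperm r (x', y')).
  rewrite -{1}(tpermV r) -conjgE tpermJ tpermL tpermD //.
    by rewrite /r xpair_eqE eqxx eq_sym.
  by rewrite eq_sym.
have [lpr lrp] := near_line_tperm lp lr.
by split; [rewrite -!mulgA tperm2 mulg1 | rewrite mulgA tperm2 mul1g].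
Qed.

Variables (x0 : X) (y0 : Y).
Let t0 : {perm X * Y} := tperm (x0, y0) (x0, b y0).

(** Parity can be an obstruction, so every permutation is first reached up to the fixed
    transposition [t0]. *)
Definition almost k s := reachN k s \/ reachN k (s * t0).

Let y0b : y0 != b y0.
Proof. by rewrite eq_sym; have := cyclic_free cyc_b y0 (k := 1); rewrite expg1; apply. Qed.
Let x0a : x0 != a x0.
Proof. by rewrite eq_sym; have := cyclic_free cyc_a x0 (k := 1); rewrite expg1; apply. Qed.

Lemma line_t0 : line_tperm t0. Proof. by left; exists x0, y0, (b y0). Qed.

(** Moving [t0] past [t] gives [t0 ^ t], again a transposition of two cells, which is traded for
    [t0] at cost 82. *)
Lemma almostM j k s t : almost j s -> almost k t -> almost (j + k + 82) (s * t).
Proof.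
have [cj1 cj2] : near 82 (t0 ^ t) t0.
  rewrite /t0 tpermJ; apply: near_tperm line_t0.
  by rewrite (inj_eq (@perm_inj _ t)) xpair_eqE eqxx.
have tt : t0 * t0 = 1 by exact: tperm2.
move=> [rs|rs] [rt|rt].
- by left; apply: (reachNW (leq_addr _ _)); apply: reachNM.
- by right; rewrite -mulgA; apply: (reachNW (leq_addr _ _)); apply: reachNM.
- right; have -> : s * t * t0 = (s * t0) * t * (t0 ^ t * t0).
    by rewrite conjgE !mulgA mulgK -(mulgA s t0) tt mulg1.
  by apply: reachNM cj1; apply: reachNM.
- left; have -> : s * t = (s * t0) * (t * t0) * (t0 * t0 ^ t).
    rewrite conjgE !mulgA -(mulgA _ t0 t0) tt mulg1 mulgK.
    by rewrite -(mulgA s t0) tt mulg1.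
  by apply: reachNM cj2; apply: reachNM.
Qed.

(** An odd [f] becomes even after one transposition in row [x], which is then traded for [t0]. *)
Lemma almost_row x f : almost 60 (row_act x f).
Proof.
have [od|ev] := boolP (odd_perm f); last first.
  by left; apply: (@reachNW _ _ _ _ 18) => //; exact: reachN_row_even.
right; pose t := tperm y0 (b y0).
have -> : row_act x f * t0 = row_act x (f * t) * (row_act x t * t0).
  by rewrite -row_actM -mulgA (mulgA (row_act x t)) row_actM tperm2 row_act1 mul1g.
apply: (@reachNM _ _ _ _ 18 42).
  by apply: reachN_row_even; rewrite // odd_permM od odd_tperm y0b.
apply: (@reachNW _ _ _ _ 41) => //; rewrite row_act_tperm.
by apply: (proj1 (near_line_tperm _ line_t0)); left; exists x, y0, (b y0).
Qed.

Lemma col_act_tperm y x x' : col_act y (tperm x x') = tperm (x, y) (x', y) :> {perm X * Y}.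
Proof. by rewrite /col_act -swap_rows_act -/(row_act _ _) row_act_tperm swap_tperm. Qed.

Lemma almost_col y f : almost 60 (col_act y f).
Proof.
have col_actM g h : col_act y g * col_act y h = col_act y (g * h) :> {perm X * Y}.
  by rewrite /col_act -!swap_rows_act -swap_permM -!/(row_act _ _) row_actM.
have [od|ev] := boolP (odd_perm f); last first.
  by left; apply: (@reachNW _ _ _ _ 18) => //; exact: reachN_col_even.
right; pose t := tperm x0 (a x0).
have -> : col_act y f * t0 = col_act y (f * t) * (col_act y t * t0).
  by rewrite -col_actM -mulgA (mulgA (col_act y t)) col_act_tperm tperm2 mul1g.
apply: (@reachNM _ _ _ _ 18 42).
  by apply: reachN_col_even; rewrite // odd_permM od odd_tperm x0a.
apply: (@reachNW _ _ _ _ 41) => //; rewrite col_act_tperm.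
by apply: (proj1 (near_line_tperm _ line_t0)); right; exists x0, (a x0), y.
Qed.

Lemma almost_rows g : almost 144 (rows_act g).
Proof.
have [f rf] := reachN_rows_but_one cyc_a cyc_b X_gt1 x0 g.
have -> : rows_act g = rows_act g * row_act x0 f * row_act x0 f^-1 by rewrite row_actV mulgK.
by apply: (@almostM 2 60); [left | exact: almost_row].
Qed.

Lemma almost_cols g : almost 144 (cols_act g).
Proof.
have [f rf] := reachN_cols_but_one cyc_a cyc_b Y_gt1 y0 g.
have -> : cols_act g = cols_act g * col_act y0 f * col_act y0 f^-1.
  rewrite -mulgA cols_actM cols_actM; apply: eq_cols_act => y.
  by case: eqP; rewrite ?mulgV !mulg1.
by apply: (@almostM 2 60); [left | exact: almost_col].
Qed.

Lemma reach_even k s : ~~ odd_perm a -> ~~ odd_perm b -> reach a b k s -> ~~ odd_perm s.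
Proof.
move=> /negPf ea /negPf eb [w _ ->].
elim: w => [|[x|y] w IH]; first by rewrite big_nil odd_perm1.
  by rewrite big_cons odd_permM odd_row_act eb.
by rewrite big_cons odd_permM /= /col_act -swap_rows_act odd_swap_perm odd_row_act ea.
Qed.

(** A transposition on a line with an odd rotation is that rotation times an even permutation of the
    line. If only [a] is odd, a column transposition is obtained in this way and traded for [t0]. *)
Lemma reachN_t0 : odd_perm a || odd_perm b -> reachN 100 t0.
Proof.
have [ob _|eb] := boolP (odd_perm b).
  rewrite /t0 -row_act_tperm -[tperm y0 _](mulKVg b) -row_actM.
  apply: (@reachNM _ _ _ _ 1 99).
    by apply: reachW (reach_generator _ _ (inl x0)); nia.
  apply: (@reachNW _ _ _ _ 18) => //; apply: reachN_row_even => //.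
  by rewrite odd_permM odd_permV ob odd_tperm y0b.
rewrite orbF => oa; rewrite -[t0]mul1g -(tperm2 (x0, y0) (a x0, y0)) -mulgA.
apply: (@reachNM _ _ _ _ 59 41); last first.
  by apply: (proj1 (near_line_tperm _ line_t0)); right; exists x0, (a x0), y0.
rewrite -col_act_tperm -[tperm x0 _](mulKVg a) /col_act -swap_rows_act.
rewrite -/(row_act _ _) -row_actM swap_permM !swap_rows_act.
apply: (@reachNM _ _ _ _ 1 58).
  by apply: reachW (reach_generator _ _ (inr y0)); nia.
apply: (@reachNW _ _ _ _ 18) => //; apply: reachN_col_even => //.
by rewrite odd_permM odd_permV oa odd_tperm x0a.
Qed.

(** Three factors of cost 144 and two products of cost 82 give 596. A leftover [t0] is then either
    reached itself, or excluded by parity when both rotations are even. *)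
Lemma reachN_rows_cols_rows g h g' :
  let s := rows_act g * cols_act h * rows_act g' in
  (~~ odd_perm a -> ~~ odd_perm b -> ~~ odd_perm s) -> reachN 700 s.
Proof.
move=> s parity.
have [rs|rs] : almost 596 s.
- apply: (@almostM 370 144); last exact: almost_rows.
  by apply: (@almostM 144 144); [exact: almost_rows | exact: almost_cols].
- exact: reachNW rs.
rewrite -(mulg1 s) -[1](tperm2 (x0, y0) (x0, b y0)) -/t0 mulgA.
have [odd_gen|even_gens] := boolP (odd_perm a || odd_perm b).
  by apply: (@reachNM _ _ _ _ 600 100); [exact: reachNW rs | exact: reachN_t0].
move: even_gens; rewrite negb_or => /andP[ea eb].
have := reach_even ea eb rs.
by rewrite odd_permM (negPf (parity ea eb)) odd_tperm xpair_eqE eqxx y0b.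
Qed.

End TorusReach.

(** * Routing by rows, columns and rows *)

(** Induction on the size of [A]. If some proper nonempty [B] has exactly [#|B|] neighbours, match
    [B], and match the rest outside these neighbours. Otherwise every such [B] has a spare
    neighbour, so one element can be matched at will and its partner deleted. *)
Lemma hall_marriage (X Z : finType) (z0 : Z) (E : X -> {set Z}) (A : {set X}) :
  (forall B : {set X}, B \subset A -> #|B| <= #|\bigcup_(x in B) E x|) ->
  exists2 f : X -> Z, {in A &, injective f} & {in A, forall x, f x \in E x}.
Proof.
have [k] := ubnP #|A|; elim: k A E => // k IH A E leAk hall.
have NS (F : X -> {set Z}) (x : X) (C : {set X}) : x \in C -> F x \subset \bigcup_(x in C) F x.
  by move=> xC; apply: (bigcup_sup x).
have [A0|[a aA]] := set_0Vmem A.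
  by exists (fun=> z0) => x; rewrite A0 inE.
have [/existsP[B /and3P[pBA B0 /eqP tight]]|/existsPn loose] :=
    boolP [exists B : {set X}, [&& B \proper A, B != set0 & #|B| == #|\bigcup_(x in B) E x|]].
- have sBA := proper_sub pBA.
  set N := \bigcup_(x in B) E x in tight.
  have [||f1 f1i f1E] := IH B E.
  + by have := proper_card pBA; lia.
  + by move=> C sCB; apply: hall; apply: subset_trans sBA.
  have [||f2 f2i f2E] := IH (A :\: B) (fun x => E x :\: N).
  + have := cardsID B A; rewrite (setIidPr sBA); move: B0; rewrite -card_gt0; lia.
  + move=> C /subsetDP[sCA dCB].
    have := hall (B :|: C); rewrite subUset sBA sCA => /(_ isT).
    rewrite cardsU disjoint_setI0 1?disjoint_sym // cards0 subn0 bigcup_setU -/N.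
    have : N :|: \bigcup_(x in C) E x \subset N :|: \bigcup_(x in C) (E x :\: N).
      apply/subsetP => z; rewrite !inE; case zN: (z \in N) => //=.
      case/bigcupP => x xC zx; apply/bigcupP; exists x => //.
      by rewrite inE zN.
    move/subset_leq_card; rewrite [X in _ <= X -> _]cardsU => le1 le2.
    by move: le1 le2; rewrite tight; lia.
  exists (fun x => if x \in B then f1 x else f2 x).
    have mix x y : x \in A -> x \notin B -> y \in B -> f1 y != f2 x.
      move=> xA xB yB; have := f2E x; rewrite !inE xB xA => /(_ isT) /andP[f2N _].
      by apply: contraNneq f2N => <-; apply: (subsetP (NS E y B yB)); exact: f1E.
    move=> x y xA yA; case: ifPn => xB; case: ifPn => yB.
    + exact: f1i.
    + by move=> e; have := mix y x yA yB xB; rewrite e eqxx.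
    + by move=> e; have := mix x y xA xB yB; rewrite e eqxx.
    + by apply: f2i; rewrite inE ?xB ?yB.
  move=> x xA; case: ifPn => xB; first exact: f1E.
  by have := f2E x; rewrite !inE xB xA => /(_ isT) /andP[].
- have [z za] : exists z, z \in E a.
    apply/set0Pn; rewrite -card_gt0.
    have := hall [set a]; rewrite sub1set aA big_set1 cards1; exact.
  have [||f fi fE] := IH (A :\ a) (fun x => E x :\ z).
  + by have := cardsD1 a A; rewrite aA; lia.
  + move=> C sC; have [->|C0] := eqVneq C set0; first by rewrite cards0.
    have pC : C \proper A.
      apply/properP; split; first exact: subset_trans sC (subsetDl _ _).
      by exists a => //; apply/negP => /(subsetP sC); rewrite !inE eqxx.
    have := loose C; rewrite pC C0 /= => ne.
    have := hall C (proper_sub pC); rewrite leq_eqVlt (negPf ne) /= => lt.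
    have : \bigcup_(x in C) E x \subset z |: \bigcup_(x in C) (E x :\ z).
      apply/subsetP => w /bigcupP[x xC wx]; rewrite !inE.
      have [//|wz] := eqVneq w z; apply/bigcupP; exists x => //.
      by rewrite !inE wz.
    by move/subset_leq_card; rewrite cardsU1; move: lt; case: (z \notin _); lia.
  exists (fun x => if x == a then z else f x).
    have mix x : x \in A -> x != a -> f x != z.
      by move=> xA xa; have := fE x; rewrite !inE xA xa => /(_ isT) /andP[].
    move=> x y xA yA; case: eqP => [->|/eqP xa]; case: eqP => [->|/eqP ya] //.
    + by move=> e; have := mix y yA ya; rewrite -e eqxx.
    + by move=> e; have := mix x xA xa; rewrite e eqxx.
    + by apply: fi; rewrite !inE ?xa ?ya.
  move=> x xA; case: eqP => [->|/eqP xa] //.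
  by have := fE x; rewrite !inE xA xa => /(_ isT) /andP[].
Qed.

Lemma sum_count_mem (Z : finType) (S : {set Z}) (s : seq Z) :
  {subset s <= S} -> \sum_(z in S) count_mem z s = size s.
Proof.
elim: s => [|x s IH] sS /=; first by rewrite big1.
have xS : x \in S by apply: sS; rewrite inE eqxx.
rewrite big_split /= IH => [|z zs]; last by apply: sS; rewrite inE zs orbT.
rewrite (bigD1 x) //= eqxx big1 // => z /andP[_ /negPf].
by rewrite eq_sym => ->.
Qed.

(** [r x] lists the neighbours of [x] in a [k]-regular bipartite multigraph. Hall's theorem yields a
    perfect matching, that is, a permutation; deleting it leaves a regular graph of degree one
    less. *)
Lemma regular_edge_colouring (X : finType) k (r : X -> seq X) :
  (forall x, size (r x) = k) -> (forall z, \sum_x count_mem z (r x) = k) ->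
  exists2 cs : seq {perm X}, size cs = k & forall x, perm_eq (r x) [seq c x | c : {perm X} <- cs].
Proof.
elim: k r => [|k IH] r size_r sum_r.
  by exists [::] => // x; rewrite (size0nil (size_r x)).
have [x0 _|X0] := pickP [pred x : X | true]; last first.
  by exists (nseq k.+1 1); [rewrite size_nseq | move=> x; have := X0 x].
have [|f fi fE] := @hall_marriage _ _ x0 (fun x => [set z in r x]) [set: X].
  move=> B _; set N := \bigcup_(x in B) _.
  (* Hall's condition by counting edges: those leaving [B] all end in [N], and every vertex receives
     [k.+1]. *)
  rewrite -(leq_pmul2r (ltn0Sn k)) -!sum_nat_const.
  rewrite (eq_bigr (fun x => \sum_(z in N) count_mem z (r x))); last first.
    move=> x xB; rewrite sum_count_mem ?size_r // => z zx.
    by apply/bigcupP; exists x; rewrite // inE.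
  rewrite exchange_big; apply: leq_sum => z _; rewrite -(sum_r z).
  by rewrite [X in _ <= X](bigID (mem B)) leq_addr.
have finj : injective f by move=> x y; apply: fi; rewrite inE.
pose p := perm finj.
have pr x : p x \in r x by have := fE x; rewrite !inE permE => /(_ isT).
have rr x := perm_to_rem (pr x).
have [||cs size_cs csP] := IH (fun x => rem (p x) (r x)).
- by move=> x; rewrite size_rem // size_r.
- move=> z; apply: succn_inj; rewrite -[RHS](sum_r z) -add1n.
  have -> : 1%N = \sum_x (p x == z).
    rewrite (bigD1 (p^-1 z)) //= permKV eqxx big1 // => x.
    by rewrite -(inj_eq (@perm_inj _ p)) permKV => /negPf ->.
  by rewrite -big_split; apply: eq_bigr => x _; rewrite (seq.permP (rr x)).
exists (p :: cs) => [|x]; first by rewrite /= size_cs.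
by rewrite (perm_trans (rr x)) //= perm_cons.
Qed.

Lemma perm_eq_reindex (Y : finType) (Z : eqType) (u v : Y -> Z) :
  perm_eq [seq u y | y <- enum Y] [seq v y | y <- enum Y] ->
  exists g : {perm Y}, forall y, u (g y) = v y.
Proof.
rewrite perm_sym => /(@tuple_permP _ _ _ (map_tuple u (enum_tuple Y)))[p e].
pose f y := enum_val (p (enum_rank y)).
have fi : injective f by move=> y y' /enum_val_inj /perm_inj /enum_rank_inj.
exists (perm fi) => y; rewrite permE /f.
have := congr1 (fun s => nth (v y) s (enum_rank y)) e.
rewrite (nth_map y) ?nth_enum_rank -?cardE // => ->.
rewrite -(tnth_nth (v y)) tnth_mktuple tnth_map (enum_val_nth y).
by rewrite (tnth_nth y).
Qed.

Lemma rows_actP (X Y : finType) (s : {perm X * Y}) :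
  (forall p, (s p).1 = p.1) -> exists g, s = rows_act g.
Proof.
move=> s1; have inj x : injective (fun y => (s (x, y)).2).
  move=> y y' e; suff [] : (x, y) = (x, y') by [].
  by apply: (@perm_inj _ s); apply/eqP; rewrite -pair_eqE /= !s1 e !eqxx.
exists (fun x => perm (inj x)); apply/permP => -[x y].
by rewrite rows_actE permE /= [LHS]surjective_pairing s1.
Qed.

(** Each cell is an edge from its row to its target row. After a colouring by columns, the first
    factor moves each cell to the column of its colour, the second to its target row, and what
    remains preserves rows. *)
Lemma rows_cols_rows (X Y : finType) (s : {perm X * Y}) :
  exists g h g', s = rows_act g * cols_act h * rows_act g'.
Proof.
pose r x := [seq (s (x, y)).1 | y <- enum Y].
have [||cs size_cs csP] := @regular_edge_colouring X #|Y| r.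
- by move=> x; rewrite size_map -cardE.
- move=> z; transitivity (\sum_(p : X * Y) ((s p).1 == z)).
    transitivity (\sum_x \sum_y ((s (x, y)).1 == z)).
      apply: eq_bigr => x _; rewrite count_map -sum1_count big_mkcond big_enum.
      by apply: eq_bigr => y _ /=; case: eqP.
    by rewrite pair_bigA; apply: eq_bigr => -[].
  rewrite (reindex_inj (@perm_inj _ s^-1)) /=.
  transitivity (\sum_x \sum_(y : Y) (x == z)).
    by rewrite pair_bigA; apply: eq_bigr => p _; rewrite permKV.
  rewrite (bigD1 z) //= [X in (_ + X)%N]big1 => [|x /negPf ->]; last by rewrite big1.
  by rewrite addn0 eqxx sum_nat_const muln1.
pose c (y : Y) := nth 1 cs (enum_rank y).
have [G GP] : exists G : X -> {perm Y}, forall x y, (s (x, G x y)).1 = c y x.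
  apply: (fin_all_exists (P := fun x g => forall y, (s (x, (g : {perm Y}) y)).1 = c y x)) => x.
  apply: (perm_eq_reindex (u := fun y => (s (x, y)).1)); apply: perm_trans (csP x) _.
  have -> : cs = [seq c y | y <- enum Y]; last by rewrite -map_comp.
  apply: (@eq_from_nth _ 1) => [|i]; rewrite size_cs; first by rewrite size_map -cardT.
  move=> iY.
  have y0 := enum_val (Ordinal iY).
  by rewrite (nth_map y0) -?cardE // /c -(enum_val_nth y0 (Ordinal iY)) enum_valK.
have [|g' g'P] := @rows_actP _ _ ((cols_act c)^-1 * rows_act G * s).
  move=> p; rewrite -[p](permKV (cols_act c)) !permM permK.
  by rewrite rows_actE GP cols_actE.
exists (fun x => (G x)^-1), c, g'.
rewrite -g'P !mulgA mulgK rows_actM (rows_act1 (g := fun x => _ * _)) ?mul1g // => x.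
exact: mulVg.
Qed.

(** * Rotations as permutations of the cells *)

Definition ordS_perm n : {perm 'I_n} := perm (@ordS_inj n).

Lemma ordS_permE n (i : 'I_n) : ordS_perm n i = ordS i.
Proof. exact: permE. Qed.

Lemma ordS_permX n k (i : 'I_n) : (ordS_perm n ^+ k) i = (i + k) %% n :> nat.
Proof.
elim: k => [|k IH]; first by rewrite perm1 addn0 modn_small.
by rewrite expgSr permM permE /= IH -addn1 modnDml addn1 addnS.
Qed.

Lemma ordS_cyclic n : cyclic (ordS_perm n).
Proof.
split; rewrite ?card_ord.
- by apply/permP => i; apply: val_inj; rewrite /= ordS_permX perm1 modnDr modn_small.
- move=> i j; have n0 : 0 < n by case: (n) i => [[]|].
  exists ((j + (n - i)) %% n); first by rewrite ltn_mod.
  apply: val_inj; rewrite /= ordS_permX modnDmr addnCA subnKC 1?ltnW //.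
  by rewrite modnDr modn_small.
- move=> i k /andP[k0 kn]; apply/eqP => /(congr1 val) /=; rewrite ordS_permX => e.
  have : i + k == i + 0 %[mod n] by rewrite addn0 e modn_small.
  by rewrite eqn_modDl mod0n modn_small // -leqn0 leqNgt k0.
Qed.

Section TorusInstance.

Variables m n : nat.
Local Notation a := (ordS_perm m).
Local Notation b := (ordS_perm n).

(** Sends the old cell of an entry to its new cell, so a sequence applied from left to right is the
    product in the same order. *)
Definition rotation_perm (r : rotation m n) : {perm 'I_m * 'I_n} :=
  match r with
  | RowRight i => row_act i b
  | RowLeft i => row_act i b^-1
  | ColDown j => col_act j a
  | ColUp j => col_act j a^-1
  end.

Lemma rotateE (A : 'M_(m, n)) r p (q := rotation_perm r p) :
  rotate A r q.1 q.2 = A p.1 p.2.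
Proof.
rewrite /q {q}; case: p r => i j [i0|i0|j0|j0];
  rewrite /rotation_perm ?rows_actE ?cols_actE mxE /=; case: eqP => _; rewrite ?perm1 //.
- by rewrite ordS_permE ordSK.
- by rewrite -ordS_permE permKV.
- by rewrite ordS_permE ordSK.
- by rewrite -ordS_permE permKV.
Qed.

Lemma rotate_seqE (A : 'M_(m, n)) s p (q := (\prod_(r <- s) rotation_perm r) p) :
  rotate_seq A s q.1 q.2 = A p.1 p.2.
Proof.
rewrite /q {q}; elim: s A p => [|r s IH] A p; first by rewrite big_nil perm1.
by rewrite big_cons permM IH rotateE.
Qed.

Lemma odd_prod_rotation s : ~~ odd_perm a -> ~~ odd_perm b ->
  ~~ odd_perm (\prod_(r <- s) rotation_perm r).
Proof.
move=> /negPf ea /negPf eb; elim: s => [|r s IH]; first by rewrite big_nil odd_perm1.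
rewrite big_cons odd_permM (negPf IH) addbF; case: r => k /=.
- by rewrite odd_row_act eb.
- by rewrite odd_row_act odd_permV eb.
- by rewrite /col_act -swap_rows_act odd_swap_perm odd_row_act ea.
- by rewrite /col_act -swap_rows_act odd_swap_perm odd_row_act odd_permV ea.
Qed.

(** Only the permutation [t] of a given sorting sequence matters, and a short word reaches it too.
    Sortability supplies the parity condition: if both cyclic shifts are even, so is [t]. *)
Lemma short_sorting_sequence (A : 'M_(m, n)) : 2 <= m -> 2 <= n -> sortable A ->
  exists s : seq (rotation m n), [/\ size s <= 700 * (m * n),
    all (@right_or_down m n) s & rotate_seq A s = sorted_mx m n].
Proof.
move=> m2 n2 [s0 sA]; set t := \prod_(r <- s0) rotation_perm r.
have [g [h [g' et]]] := rows_cols_rows t.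
have [w wk ew] : reachN a b 700 t.
  rewrite et; apply: reachN_rows_cols_rows; rewrite ?card_ord //.
  - exact: ordS_cyclic.
  - exact: ordS_cyclic.
  - exact: (Ordinal (ltnW m2)).
  - exact: (Ordinal (ltnW n2)).
  - by rewrite -et; exact: odd_prod_rotation.
pose s := [seq match r with inl i => RowRight i | inr j => ColDown j end | r <- w].
have es : \prod_(r <- s) rotation_perm r = t.
  by rewrite ew big_map; apply: eq_bigr => -[].
exists s; split.
- by rewrite size_map; move: wk; rewrite !card_ord.
- by rewrite all_map; apply/allP => -[].
apply/matrixP => i j; pose p := t^-1 (i, j).
have := rotate_seqE A s p; rewrite es permKV /= => ->.
by have := rotate_seqE A s0 p; rewrite -/t permKV /= sA => ->.
Qed.

End TorusInstance.

Close Scope group_scope.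

(** * Correctness of the search *)

Section SearchCorrectness.

Variables m n : nat.
Local Notation rotation := (rotation m.+1 n.+1).
Local Notation cell := (fun p : 'I_m.+1 * 'I_n.+1 => p.1 * n.+1 + p.2).

Definition digit_rotation d : rotation :=
  if d < m.+1 then RowRight (inord d) else ColDown (inord (d - m.+1)).

Definition digits_rotations k := map digit_rotation (digits (m.+1 + n.+1) k).

Lemma digit_rotation_code d : d < m.+1 + n.+1 ->
  rotation_code (digit_rotation d) = digit_code m.+1 d.
Proof.
by rewrite /digit_rotation /digit_code => dB; case: ifPn => dm /=; rewrite inordK //; lia.
Qed.

Lemma move_cellE d p : d < m.+1 + n.+1 ->
  move_cell m.+1 n.+1 d (cell p) = cell (rotation_perm (digit_rotation d) p).
Proof.
case: p => i j dB; rewrite /move_cell /= divnMDl // modnMDl (divn_small (ltn_ord j)) (modn_small (ltn_ord j)) addn0.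
rewrite /digit_rotation; case: ifPn => dm; rewrite ?rows_actE ?cols_actE /=.
  rewrite -val_eqE /= inordK //; case: eqP => _; rewrite ?perm1 //.
  by rewrite ordS_permE.
rewrite -val_eqE /= inordK; last by lia.
by case: eqP => _; rewrite ?perm1 // ordS_permE.
Qed.

Lemma trackE k p :
  track m.+1 n.+1 k (cell p) = cell ((\prod_(r <- digits_rotations k) rotation_perm r)%g p).
Proof.
rewrite /track /digits_rotations.
have /allP := all_digits k (isT : 0 < m.+1 + n.+1).
elim: (digits _ k) p => [|d ds IH] p dB; first by rewrite big_nil perm1.
rewrite big_cons permM -IH => [|d' d'ds]; last by apply: dB; rewrite inE d'ds orbT.
by rewrite -move_cellE // dB ?inE ?eqxx.
Qed.

Lemma rotate_seq_sorted (A : 'M_(m.+1, n.+1)) (s : seq rotation) :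
  rotate_seq A s = sorted_mx m.+1 n.+1 <->
  forall p, A p.1 p.2 = (cell ((\prod_(r <- s) rotation_perm r)%g p)).+1.
Proof.
split=> [e p|e]; first by rewrite -(rotate_seqE A s) e mxE addn1.
apply/matrixP => i j; have := rotate_seqE A s ((\prod_(r <- s) rotation_perm r)^-1%g (i, j)).
by rewrite permKV /= => ->; rewrite e permKV mxE addn1.
Qed.

Lemma iota_allpairs k l : iota 0 (k * l) = [seq i * l + j | i <- iota 0 k, j <- iota 0 l].
Proof.
elim: k => // k IH; rewrite mulSnr iotaD IH -[in RHS]addn1 iotaD allpairs_cat add0n /= cats0.
by rewrite -[k * l in LHS]addn0 iotaDl.
Qed.

(** The word sorts [A] exactly when each entry is one more than the number of the cell where it
    ends; injectivity of the coding reduces the left side to the same entrywise condition. *)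
Lemma matrix_codeE (A : 'M_(m.+1, n.+1)) k :
  matrix_code m.+1 n.+1 k = CodeSeq.code [seq A i j | i <- enum 'I_m.+1, j <- enum 'I_n.+1] <->
  rotate_seq A (digits_rotations k) = sorted_mx m.+1 n.+1.
Proof.
rewrite rotate_seq_sorted /matrix_code iota_allpairs map_allpairs.
rewrite -!val_enum_ord allpairs_mapl allpairs_mapr.
split=> [/(can_inj CodeSeq.codeK)/eq_in_allpairs e [i j]|e].
  by rewrite -(trackE k (i, j)) -e ?mem_enum.
congr CodeSeq.code; apply: eq_allpairs => i j.
by rewrite (e (i, j)) -(trackE k (i, j)).
Qed.

Lemma digits_rotations_onto (s : seq rotation) : all (@right_or_down _ _) s ->
  exists k, digits_rotations k = s.
Proof.
pose d (r : rotation) := match r with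
  | RowRight i | RowLeft i => val i | ColDown j | ColUp j => m.+1 + val j end.
move=> rd; have [|k ek] := @digits_onto (m.+1 + n.+1) (map d s).
  by elim: s {rd} => //= r s ->; rewrite andbT; case: r => i /=; rewrite ?ltn_add2l ?ltn_addr.
exists k; rewrite /digits_rotations ek -map_comp.
elim: s rd {ek} => //= r s IH /andP[rd_r /IH ->]; congr (_ :: _).
case: r rd_r => //= i _; rewrite /digit_rotation; first by rewrite ltn_ord inord_val.
by rewrite ltnNge leq_addr /= addKn inord_val.
Qed.

End SearchCorrectness.

(** The constant doubles because [ln (INR l)] exceeds 1/2. *)
Lemma nat_bound_ln (k p l : nat) : k <= 700 * p -> 2 <= l ->
  (INR k <= 1400 * INR p * ln (INR l))%Re.
Proof.
move=> /leP/le_INR; rewrite mult_INR => kp /leP/le_INR l2.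
have INR700 : INR 700 = 700%Re by rewrite INR_IZR_INZ.
have ln2 : (/ 2 < ln (INR l))%Re.
  apply: (Rlt_le_trans _ _ _ ln_lt_2).
  by case: l2 => [lt2|<-]; [apply/Rlt_le/ln_increasing; first exact: Rlt_0_2 | exact: Rle_refl].
have p0 := pos_INR p; rewrite INR700 in kp.
apply: Rle_trans kp _; nra.
Qed.

Theorem theorem12 :
  exists (c : R) (alg : program),
    (0 < c)%Re /\
    forall (m n : nat) (A : 'M[nat]_(m, n)),
      2 <= m -> 2 <= n -> torus_instance A -> sortable A ->
      exists s : seq (rotation m n),
        [/\ outputs alg A s,
            (INR (size s) <= c * INR (m * n) * ln (INR (maxn m n)))%Re,
            all (@right_or_down m n) s
          & rotate_seq A s = sorted_mx m n].
Proof.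
have [alg algP] := search_program.
exists 1400%Re, alg; split; first by apply: IZR_lt.
move=> [|m] [|n] // A m2 n2 _ sA.
have [s0 [size_s0 rd_s0 sorted_s0]] := short_sorting_sequence m2 n2 sA.
have [k0 ek0] := digits_rotations_onto rd_s0.
set C := CodeSeq.code [seq A i j | i <- enum 'I_m.+1, j <- enum 'I_n.+1].
have found : exists k, matrix_code m.+1 n.+1 k == C.
  by exists k0; apply/eqP/matrix_codeE; rewrite ek0.
case: (ex_minnP found) => k /eqP ek min_k.
exists (digits_rotations m n k); split.
- rewrite /outputs /program_input -/C -map_comp.
  have -> : [seq (@rotation_code _ _ \o digit_rotation m n) d | d <- digits (m.+1 + n.+1) k] =
            [seq digit_code m.+1 d | d <- digits (m.+1 + n.+1) k].
    apply/eq_in_map => d; have /allP dB := all_digits k (isT : 0 < m.+1 + n.+1).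
    by move/dB; exact: digit_rotation_code.
  apply: algP => // j lt_j; apply: contraL lt_j => ej.
  by rewrite -leqNgt; exact: min_k.
- apply: nat_bound_ln; last by rewrite leq_max m2.
  (* The word found may differ from [s0], but its code is at most [k0], hence it is no longer. *)
  apply: leq_trans size_s0; rewrite -ek0 /digits_rotations !(size_map (digit_rotation m n)).
  apply: size_digits_leq.
  by apply: min_k; apply/eqP/matrix_codeE; rewrite ek0.
- rewrite /digits_rotations; elim: (digits _ k) => //= d ds ->.
  by rewrite andbT /digit_rotation; case: ifP.
- exact/matrix_codeE.
Qed.
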